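(* Let $M$ and $\tilde M$ be unipotent manifolds (defined in the context), with characteristic polynomials $Q_M(s)$ and $Q_{\tilde M}(s)$. Then $M$ and $\tilde M$ are causally isometric if and only if their signatures coincide, $(n,m,r,k)=(\tilde n,\tilde m,\tilde r,\tilde k)$, and there exist $X\in \mathrm{GL}(m,\mathbb{Z})$, $\alpha>0$ and $\beta\in\mathbb{R}$ such that $$Q_M(s)=X^\top Q_{\tilde M}(\alpha s+\beta)X\qquad\text{for all } s\in\mathbb{R}.$$
   Context: Main construction. Let $V$ be a real vector space of dimension $n\ge 2$ with a symmetric bilinear form $\ell$ of signature $(+,-,\dots,-)$, and let $C$ be one of the two closed convex cones whose union is $\{v:\ell(v,v)\ge0\}$. Let $v_0,v_1\in\partial C$ satisfy $\ell(v_0,v_1)=1$ and put $L=\mathbb{R}v_0$, $W=L^\perp$, $N=W\cap v_1^\perp$, $l_0(v)=\ell(v_0,v)$ (orthogonal complements are with respect to $\ell$; $\ell$ is negative definite on $N$). Let $T\subseteq N$ be a linear subspace, $\Gamma$ a lattice (cocompact discrete subgroup) in $T$, and $a:T\to N$ a linear map with $\ell(ax,y)=\ell(x,ay)$ for $x,y\in T$ and $\ker(\mathbf 1+sa)=0$ for all $s\in\mathbb{R}$, where $(\mathbf 1+sa)x=x+s\,ax$. The vector group $T$ acts on $V$ by $\gamma_x(v)=\lambda(x)v+\tau(x)$, $x\in T$, where $$\lambda(x)v=v+l_0(v)ax-\Big(\ell(ax,v)+\tfrac12 l_0(v)\ell(ax,ax)\Big)v_0,\qquad \tau(x)=x-\tfrac12\ell(ax,x)v_0.$$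 Under these conditions $\Gamma$ acts on $V$ freely and properly by $x\mapsto\gamma_x$; the quotient $M=M(v_0,v_1,T,a,\Gamma)=V/\Gamma$ is a Lorentzian manifold with the metric induced by $\ell$ and the field of cones induced by $C$. A unipotent manifold is a Lorentzian manifold (with cone field) that admits a realization $M(v_0,v_1,T,a,\Gamma)$. An isometry between such manifolds is causal if it preserves the orientation of timelike curves (curves whose velocity lies in the cone field), and two manifolds are causally isometric if there is a causal isometry between them. Signature. Write $a=a'+a''$ where $a':T\to T$ is determined by $\ell(a'x,y)=\ell(ax,y)$ for $x,y\in T$, and $a'':T\to T^\perp\cap N$. Put $R=a''T$. The signature of $M$ is $(n,m,r,k)$ with $n=\dim M$, $m=\dim T$, $r=\dim R$, $k=\dim\ker a$; it does not depend on the realization. Characteristic polynomial. Choose a realization of $M$ and a linear isomorphism $\iota:\mathbb{R}^m\to T$ with $\iota\,\mathbb{Z}^m=\Gamma$. For $x\in T$, $s\in\mathbb{R}$ put $q_s(x)=-\ell((\mathbf 1+sa)x,(\mathbf 1+sa)x)$ (this equals $-\ell(\gamma_x(v)-v,\gamma_x(v)-v)$ for any $v$ with $l_0(v)=s$). There are unique symmetric real $m\times m$ matrices $A,B,C$ such that $q_s(\iota z)=\langle (A+2sB+s^2C)z,z\rangle$ for all $z\in\mathbb{R}^m$, $s\in\mathbb{R}$, where $\langle\cdot,\cdot\rangle$ is the standard inner product (here $C$ is a matrix, not the cone). Then $Q_M(s)=A+2sB+s^2C$ is called a characteristic polynomial of $M$; it is considered up to orientation-preserving affine changes of the variable $s$,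 and $Q_M$, $Q_{\tilde M}$ denote any characteristic polynomials obtained in this way. *)

(* Defs.v *)
From HB Require Import structures.
From mathcomp Require Import all_boot all_order all_algebra.
From mathcomp Require Import all_classical all_reals all_analysis.

Set Implicit Arguments.
Unset Strict Implicit.
Unset Printing Implicit Defensive.

Import Order.TTheory GRing.Theory Num.Theory.
Import numFieldNormedType.Exports.

Local Open Scope classical_set_scope.
Local Open Scope ring_scope.

Section Smooth.
Variables (R : realType) (V W : normedModType R).

(* [Ck k U F]: [F] is of class C^k on the open set [U]; when [V] has finite
   dimension, all iterated directional derivatives being continuous is the
   usual notion. *)
Fixpoint Ck (k : nat) (U : set V) (F : V -> W) : Prop :=
  if k is k'.+1 then
    (forall x, U x -> differentiable F x) /\
    (forall v, Ck k' U (fun x => 'D_v F x))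
  else forall x, U x -> {for x, continuous F}.

Definition smooth_on (U : set V) (F : V -> W) : Prop := forall k, Ck k U F.

End Smooth.

Section Cones.
Variables (R : realType) (n : nat).
Local Notation V := 'rV[R]_n.
Implicit Types (ell : {symmetric V}) (C : set V).

Definition lorentzian_form ell : Prop :=
  exists e : n.-tuple V, basis_of fullv e /\
    forall i j : 'I_n, ell (tnth e i) (tnth e j) =
      if i != j then 0 else if i == 0 :> nat then 1 else -1.

Definition closed_convex_cone C : Prop :=
  closed C /\
  forall (s t : R) (x y : V), 0 <= s -> 0 <= t -> C x -> C y ->
    C (s *: x + t *: y).

Definition half_cone ell C : Prop :=
  exists C' : set V, [/\ closed_convex_cone C, closed_convex_cone C'
    & C `|` C' = [set v | 0 <= ell v v]].

Definition boundary C : set V := closure C `\` interior C.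

End Cones.

(* The data (v_0, v_1, T, a, Gamma), together with the space V = R^n, the form
   ell and the cone C.  As ell is an arbitrary Lorentzian form, taking R^n for V
   amounts to a choice of basis. *)
Record realization (R : realType) := Realization {
  dimV : nat;
  dimV_ge2 : (2 <= dimV)%N;
  ell : {symmetric 'rV[R]_dimV};
  ell_lorentzian : lorentzian_form ell;
  cone : set 'rV[R]_dimV;
  coneP : half_cone ell cone;
  v0 : 'rV[R]_dimV;
  v1 : 'rV[R]_dimV;
  v0_boundary : boundary cone v0;
  v1_boundary : boundary cone v1;
  ell_v0v1 : ell v0 v1 = 1;
  spaceW : {vspace 'rV[R]_dimV} := orthov ell <[v0]>;
  spaceN : {vspace 'rV[R]_dimV} := (spaceW :&: orthov ell <[v1]>)%VS;
  spaceT : {vspace 'rV[R]_dimV};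
  spaceT_sub : (spaceT <= spaceN)%VS;
  Gamma : set (subvs_of spaceT);
  Gamma0 : Gamma 0;
  GammaB : forall x y, Gamma x -> Gamma y -> Gamma (x - y);
  Gamma_discrete : vsval @` Gamma `<=` isolated (vsval @` Gamma);
  Gamma_cocompact : exists2 K : set 'rV[R]_dimV, compact K &
    forall x, exists2 g, Gamma g & K (vsval (x - g));
  mapa : 'Hom(subvs_of spaceT, 'rV[R]_dimV);
  mapa_sub : (limg mapa <= spaceN)%VS;
  mapa_sym : forall x y, ell (mapa x) (vsval y) = ell (vsval x) (mapa y);
  mapa_ker : forall (s : R) x, vsval x + s *: mapa x = 0 -> x = 0
}.

Arguments cone {R} r.
Arguments Gamma {R} r.
Arguments mapa {R} r.
Arguments ell {R} r.
Arguments v0 {R} r.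
Arguments v1 {R} r.
Arguments spaceT {R} r.
Arguments spaceN {R} r.
Arguments spaceW {R} r.
Arguments dimV {R} r.

Section Quotient.
Variables (R : realType) (M : realization R).
Local Notation V := 'rV[R]_(dimV M).
Local Notation T := (subvs_of (spaceT M)).
Local Notation l := (ell M).
Local Notation a := (mapa M).

Definition l0 (v : V) : R := l (v0 M) v.

Definition lambda (x : T) (v : V) : V :=
  v + l0 v *: a x - (l (a x) v + 2^-1 * l0 v * l (a x) (a x)) *: v0 M.

Definition tau (x : T) : V := vsval x - (2^-1 * l (a x) (vsval x)) *: v0 M.

Definition gamma (x : T) (v : V) : V := lambda x v + tau x.

Definition orbit (v : V) : set V := [set gamma x v | x in Gamma M].

Definition manifold : Type := {A : set V | range orbit A}.

Definition proj (v : V) : manifold := exist _ (orbit v) (imageT orbit v).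

(* Gamma acts freely and properly, so [proj] is a covering, through which
   V / Gamma gets its smooth structure, its metric and its field of cones.
   Smoothness, differentials and velocities in the quotient are therefore those
   of local lifts to V. *)
Definition timelike_curve (I : set R) (c : R -> manifold) : Prop :=
  forall t, I t -> exists (J : set R) (c' : R -> V),
    [/\ open J, J t, smooth_on J c',
        forall s, J s -> proj (c' s) = c s &
        forall s, J s -> cone M (derive1 c' s)].

Definition dimT : nat := \dim (spaceT M).

(* [map_a'] is the map a' : T -> T (the default value 0 is never used: ell is
   negative definite on T, so a' exists and is unique). *)
Definition map_a' : 'End(T) :=
  xget 0 [set b : 'End(T) |
    forall x y : T, l (vsval (b x)) (vsval y) = l (a x) (vsval y)].

Definition map_a'' : 'Hom(T, V) := a - (linfun vsval \o map_a')%VF.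

Definition spaceR : {vspace V} := limg map_a''.

Definition signature : nat * nat * nat * nat :=
  (dimV M, dimT, \dim spaceR, \dim (lker a)).

Definition qform (s : R) (x : T) : R :=
  - l (vsval x + s *: a x) (vsval x + s *: a x).

Definition characteristic_polynomial (Q : R -> 'M[R]_dimT) : Prop :=
  exists (iota : 'Hom('cV[R]_dimT, T)) (A B C : 'M[R]_dimT),
    [/\ bijective iota,
        iota @` range (map_mx intr : 'cV[int]_dimT -> 'cV[R]_dimT) = Gamma M,
        [/\ A^T = A, B^T = B & C^T = C],
        forall s (z : 'cV[R]_dimT), qform s (iota z) =
          \sum_i ((A + (2 * s) *: B + s ^+ 2 *: C) *m z) i 0 * z i 0 &
        forall s, Q s = A + (2 * s) *: B + s ^+ 2 *: C].

End Quotient.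

Arguments characteristic_polynomial {R} M Q.

Section Isometry.
Variables (R : realType) (M M' : realization R).

Definition local_lift (f : manifold M -> manifold M')
    (U : set 'rV[R]_(dimV M)) (F : 'rV[R]_(dimV M) -> 'rV[R]_(dimV M')) : Prop :=
  [/\ open U, smooth_on U F & forall v, U v -> proj (F v) = f (proj v)].

Definition smooth_map (f : manifold M -> manifold M') : Prop :=
  forall v, exists U F, U v /\ local_lift f U F.

Definition preserves_metric (f : manifold M -> manifold M') : Prop :=
  forall U F, local_lift f U F -> forall v, U v -> forall x y,
    ell M' ('d F v x) ('d F v y) = ell M x y.

Definition causal (f : manifold M -> manifold M') : Prop :=
  forall (I : set R) (c : R -> manifold M), open I -> is_interval I ->
    timelike_curve I c -> timelike_curve I (f \o c).

End Isometry.

Definition is_isometry (R : realType) (M M' : realization R)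
    (f : manifold M -> manifold M') : Prop :=
  preserves_metric f /\ smooth_map f /\
  exists2 g : manifold M' -> manifold M, smooth_map g & cancel f g /\ cancel g f.

Definition causally_isometric (R : realType) (M M' : realization R) : Prop :=
  exists f : manifold M -> manifold M', is_isometry f /\ causal f.

(* Main.v *)
Require Import Defs.
From HB Require Import structures.
From mathcomp Require Import all_boot all_order all_algebra.
From mathcomp Require Import all_classical all_reals all_analysis.
From mathcomp Require Import ring lra.

Set Implicit Arguments.
Unset Strict Implicit.
Unset Printing Implicit Defensive.

Import Defs Order.TTheory GRing.Theory Num.Theory.
Import numFieldNormedType.Exports.
Local Open Scope classical_set_scope.
Local Open Scope ring_scope.

(** Put q_s(x) = - l((1 + s a) x, (1 + s a) x).  Both directions go through an
affine isometry F : V -> V' with F gamma_x = gamma'_(phi x) F for a linear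
bijection phi of the lattices, and through
q_s(x) = q'_(alpha s + beta)(phi x).

Given an isometry of the quotients, a local lift F is affine, because
l'(D_z D_x F, D_y F) is symmetric in x, z and skew in x, y.  Local lifts differ
by elements of Gamma', so one of them extends to all of V, and it conjugates
Gamma to Gamma'.  As q_s(x) = - l(gamma_x v - v, gamma_x v - v) when
l_0(v) = s, we get Q(l_0(v)) = X^T Q'(l_0'(F v)) X for every v.  If l_0' o F is not
a function of l_0, then Q' is constant; otherwise l_0'(F v) = alpha l_0(v) + beta,
and alpha > 0 because l_0 increases along timelike curves.

Conversely, polarizing q_s(x) = q'_(alpha s + beta)(phi x) shows that
v_0 |-> v_0' / alpha, v_1 |-> alpha v_1', x |-> (1 + beta a') (phi x) and
a x |-> alpha a' (phi x) preserve inner products.  They extend to an isometry L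
by reflections, and F = L + beta v_1' intertwines the two actions. *)

(** Everything on the quotients is expressed through local lifts, so both directions need lifts to
    be unique up to [Gamma]. This rests on a lower bound for 1 + s a that is uniform for s near a
    given value.

    In the polarized identity, the coefficient of s only shows the sum of the mixed products l(x, a
    y) and l(a x, y); the symmetry of a and a' separates them. Reflections need vectors of nonzero
    norm: once the timelike v_0 + v_1 is in place, every further discrepancy is orthogonal to a
    timelike vector, hence spacelike or zero. The translation by beta v_1' produces the shift in
    l_0'(F v) = alpha l_0(v) + beta.

    The number k is dim ker a, and r is m - dim ker a''. As N is definite, the vanishing of a vector
    of N can be read off its norm, so these kernels are carried over by phi and a twist of phi; the
    inverse map gives the opposite inequalities. *)

(** * Lorentzian linear algebra, and half cones described by inequalities *)

Section SymmetricForm.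
Variables (R : realType) (n : nat) (b : {symmetric 'rV[R]_n}).
Local Notation V := 'rV[R]_n.
Implicit Types (u v w : V) (c : R).

Lemma formDl u v w : b (u + v) w = b u w + b v w.
Proof. exact: linearDl. Qed.
Lemma formDr u v w : b u (v + w) = b u v + b u w.
Proof. exact: linearDr. Qed.
Lemma formZl c u v : b (c *: u) v = c * b u v.
Proof. exact: linearZl_LR. Qed.
Lemma formZr c u v : b u (c *: v) = c * b u v.
Proof. exact: linearZr_LR. Qed.
Lemma formNl u v : b (- u) v = - b u v.
Proof. exact: linearNl. Qed.
Lemma formNr u v : b u (- v) = - b u v.
Proof. exact: linearNr. Qed.
Lemma form0l v : b 0 v = 0.
Proof. exact: linear0l. Qed.
Lemma form0r v : b v 0 = 0.
Proof. exact: linear0r. Qed.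
Lemma formC u v : b u v = b v u.
Proof. by rewrite hermC expr0 mul1r. Qed.
Definition formE := (formDl, formDr, formZl, formZr, formNl, formNr, form0l, form0r).

Lemma form_suml (I : Type) (r : seq I) (P : pred I) (F : I -> V) v :
  b (\sum_(i <- r | P i) F i) v = \sum_(i <- r | P i) b (F i) v.
Proof. exact: linear_sumlz. Qed.
Lemma form_sumr (I : Type) (r : seq I) (P : pred I) (F : I -> V) v :
  b v (\sum_(i <- r | P i) F i) = \sum_(i <- r | P i) b v (F i).
Proof. exact: linear_sumr. Qed.

End SymmetricForm.

Section Lorentz.
Variables (R : realType) (n : nat) (b : {symmetric 'rV[R]_n}).
Hypotheses (n2 : (2 <= n)%N) (hb : lorentzian_form b).
Local Notation V := 'rV[R]_n.
Implicit Types (u v w : V) (c : R).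

(** The first basis vector serves as the axis: on its complement, b v v is minus a sum of squares of
    coordinates. *)
Lemma lorentz_axis :
  exists e, b e e = 1 /\ forall v, b e v = 0 -> v != 0 -> b v v < 0.
Proof.
have [e [/andP[/eqP ef eF] eo]] := hb.
have i0 : 'I_n by exists 0%N; apply: leq_trans n2.
pose z : 'I_n := Ordinal (leq_trans (isT : (0 < 2)%N) n2).
exists (tnth e z); split; first by rewrite eo eqxx.
move=> v ev v0.
have vE : v = \sum_i coord e i v *: tnth e i.
  under eq_bigr do rewrite (tnth_nth 0).
  by apply: coord_span; rewrite ef memvf.
have bvi i : b v (tnth e i) = coord e i v * (if i == 0 :> nat then 1 else -1).
  rewrite {1}vE form_suml (bigD1 i) //= formZl eo eqxx /= big1 ?addr0 // => j ji.
  by rewrite formZl eo ji mulr0.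
have cz : coord e z v = 0.
  by rewrite formC bvi eqxx mulr1 in ev.
have bvv : b v v = - \sum_i coord e i v ^+ 2.
  rewrite {2}vE form_sumr -sumrN; apply: eq_bigr => i _.
  rewrite formZr bvi; case: ifP => [/eqP i0'|_]; last by ring.
  by rewrite (_ : i = z) ?cz; [ring|apply: val_inj].
rewrite bvv oppr_lt0 lt_neqAle sumr_ge0 ?andbT; last by move=> i _; apply: sqr_ge0.
apply/negP => /eqP/esym/psumr_eq0P H.
case/negP: v0; rewrite vE big1 // => i _.
have /eqP : coord e i v ^+ 2 = 0 by apply: H => // j _; apply: sqr_ge0.
by rewrite sqrf_eq0 => /eqP->; rewrite scale0r.
Qed.

(** The combination [w] of u and v is orthogonal to the axis e. If b v v >= 0, then b w w >= 0, so w
    = 0 by negativity there; expanding b w w forces b e v = 0, and w = 0 reduces to v = 0. *)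
Lemma timelike_orthogonal u v : 0 < b u u -> b u v = 0 -> v != 0 -> b v v < 0.
Proof.
have [e [e1 en]] := lorentz_axis => u0 uv v0; rewrite ltNge; apply/negP => vv.
pose w := b e v *: u - b e u *: v.
have ew : b e w = 0 by rewrite !formE; ring.
have ww : b w w = b e v ^+ 2 * b u u + b e u ^+ 2 * b v v.
  by rewrite !formE (formC b v u) uv; ring.
have eu : b e u != 0.
  apply/eqP => eu; have un0 : u != 0 by apply/eqP => E; rewrite E form0l ltxx in u0.
  by have := lt_trans u0 (en _ eu un0); rewrite ltxx.
have w0 : w = 0.
  apply/eqP/negPn/negP => w0; have := en _ ew w0.
  by rewrite ww ltNge addr_ge0 // mulr_ge0 ?sqr_ge0 // ltW.
move: ww; rewrite w0 form0l => /eqP; rewrite eq_sym paddr_eq0; last 2 first.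
- by rewrite mulr_ge0 ?sqr_ge0 // ltW.
- by rewrite mulr_ge0 ?sqr_ge0.
case/andP => /eqP ev _; move: ev => /eqP.
rewrite mulf_eq0 (gt_eqF u0) orbF sqrf_eq0 => /eqP ev.
move: w0; rewrite /w ev scale0r sub0r => /eqP; rewrite oppr_eq0 scaler_eq0.
by rewrite (negbTE eu) (negbTE v0).
Qed.

Lemma lorentz_nondegenerate v : (forall w, b v w = 0) -> v = 0.
Proof.
have [e [e1 en]] := lorentz_axis => H; apply/eqP/negPn/negP => v0.
have : b e v = 0 by rewrite formC.
by move/en => /(_ v0); rewrite H ltxx.
Qed.

Lemma orthogonal_vector u : exists2 v, b u v = 0 & v != 0.
Proof.
pose K := lker (linfun (b u : V -> R^o)).
have : (0 < \dim K)%N.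
  have := limg_ker_dim (linfun (b u : V -> R^o)) fullv.
  rewrite capfv dimvf /dim /= mul1n.
  have := dimvS (subvf (limg (linfun (b u : V -> R^o)))).
  rewrite dimvf /dim /= => h1 h2; rewrite /K.
  case: (\dim (lker _)) h2 => // h2; have h3 := n2; rewrite -h2 add0n ltnNge h1 // in h3.
rewrite lt0n dimv_eq0 => K0; exists (vpick K); last by rewrite vpick0.
by have := memv_pick K; rewrite memv_ker lfunE /= => /eqP.
Qed.

(* If b u v < 0, then C contains -u; choosing z orthogonal to u and small, the
   vectors u + z and - u + z must both lie in C', hence so does the spacelike 2 z. *)
Lemma cone_pairing C C' u v : closed_convex_cone C -> closed_convex_cone C' ->
  C `|` C' = [set v | 0 <= b v v] ->
  C u -> C v -> 0 < b u u -> 0 <= b u v.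
Proof.
move=> [_ hC] [_ hC'] CC' Cu Cv u0; rewrite leNgt; apply/negP => uv.
have CE x : 0 <= b x x -> C x \/ C' x.
  by move=> h; have : (C `|` C') x by rewrite CC'.
have Cge x : C x -> 0 <= b x x.
  by move=> h; suff : (C `|` C') x by [rewrite CC']; left.
have C'ge x : C' x -> 0 <= b x x.
  by move=> h; suff : (C `|` C') x by [rewrite CC']; right.
(* Chosen so that u + t v is orthogonal to u; a vector of C is not spacelike, so this one must be
   zero. *)
pose t := - b u u / b u v.
have t0 : 0 < t by rewrite /t mulNr -mulrN -invrN divr_gt0 // oppr_gt0.
have Cw : C (1 *: u + t *: v) by apply: hC => //; rewrite ltW.
have tv : t *: v = - u.
  apply/eqP; rewrite -addr_eq0; apply/negPn/negP => H; move: (Cge _ Cw).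
  rewrite scale1r addrC leNgt; apply/negP/negPn.
  apply: (timelike_orthogonal u0) => //.
  by rewrite formDr formZr /t -mulrA mulVf ?lt_eqF // mulr1 addNr.
have CNu : C (- u).
  have -> : - u = t *: v + 0 *: u by rewrite scale0r addr0.
  by apply: hC => //; rewrite ltW.
have [z uz z0] := orthogonal_vector u.
have zz := timelike_orthogonal u0 uz z0.
(* Small enough that e^2 |b z z| <= b u u, so neither u + e z nor - u + e z is spacelike. *)
pose e := Num.min 1 (b u u / (- b z z)).
have e0 : 0 < e by rewrite /e lt_min ltr01 divr_gt0 // oppr_gt0.
have ez : 0 <= b u u + e ^+ 2 * b z z.
  have h1 : e * e <= 1 * (b u u / (- b z z)).
    by apply: ler_pM; rewrite ?(ltW e0) // /e ge_min lexx ?orbT.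
  move: h1; rewrite mul1r ler_pdivlMr ?oppr_gt0 //.
  lra.
have Cz x : x = u \/ x = - u -> C' (x + e *: z).
  move=> hx.
  have Cx : C x by case: hx => ->.
  have CNx : C (- x) by case: hx => ->; rewrite ?opprK.
  case: (CE (x + e *: z)) => //.
    suff -> : b (x + e *: z) (x + e *: z) = b u u + e ^+ 2 * b z z by [].
    by case: hx => ->; rewrite !formE (formC b z u) uz; ring.
  move=> h; have := hC 1 1 _ _ ler01 ler01 h CNx => /Cge.
  rewrite !scale1r addrAC subrr add0r !formE mulrA leNgt nmulr_llt0 //.
  by rewrite mulr_gt0.
have /C'ge := hC' 1 1 _ _ ler01 ler01 (Cz u (or_introl erefl)) (Cz (- u) (or_intror erefl)).
rewrite !scale1r addrACA subrr add0r -scalerDl !formE mulrA leNgt nmulr_llt0 //.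
by rewrite mulr_gt0 ?addr_gt0.
Qed.

End Lorentz.

Section LinearRegularity.
Variables (R : realType) (n : nat) (W : normedModType R).

Lemma linear_rV_differentiable (f : {linear 'rV[R]_n -> W}) v : differentiable f v.
Proof.
pose g j : 'rV[R]_n -> W := fun v => v ord0 j *: f (delta_mx ord0 j).
have -> : (f : 'rV[R]_n -> W) = \sum_j g j.
  apply/funext => u; rewrite fct_sumE {1}(row_sum_delta u) linear_sum.
  by apply: eq_bigr => j _; rewrite linearZ.
apply: differentiable_sum => j; apply: differentiableZl.
exact: differentiable_coord.
Qed.

Lemma linear_rV_continuous (f : {linear 'rV[R]_n -> W}) : continuous f.
Proof. by move=> v; apply/differentiable_continuous/linear_rV_differentiable. Qed.

End LinearRegularity.

Lemma nonneg_pair (R : realType) (p q : R) :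
  0 <= p + q -> 0 <= p * q -> 0 <= p /\ 0 <= q.
Proof. by move=> h1 h2; have [p0|p0] := lerP 0 p; split=> //; nra. Qed.

Section HalfCone.
Variables (R : realType) (n : nat) (b : {symmetric 'rV[R]_n}).
Hypotheses (n2 : (2 <= n)%N) (hb : lorentzian_form b).
Local Notation V := 'rV[R]_n.

Lemma form_differentiable (u v : V) : differentiable (b u : V -> R^o) v.
Proof.
have lin : linear (b u : V -> R^o) by move=> c x y; rewrite formDr formZr.
pose f : {linear V -> R^o} := HB.pack (b u : V -> R^o) (GRing.isLinear.Build _ _ _ _ _ lin).
exact: (linear_rV_differentiable f).
Qed.

Lemma form_continuous (u : V) : continuous (b u : V -> R).
Proof. by move=> v; apply: differentiable_continuous (form_differentiable u v). Qed.

Lemma form_diag_continuous : continuous (fun v : V => b v v).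
Proof.
pose g j : V -> R^o := fun v => v ord0 j * b (delta_mx ord0 j) v.
have -> : (fun v : V => b v v) = \sum_j g j.
  apply/funext => u; rewrite fct_sumE {1}(row_sum_delta u) form_suml.
  by apply: eq_bigr => j _; rewrite formZl.
move=> v; apply: differentiable_continuous; apply: differentiable_sum => j.
apply: differentiableM; first exact: differentiable_coord.
exact: form_differentiable.
Qed.

Variables (C : set V) (v0 v1 : V).
Hypotheses (hC : half_cone b C) (bv0 : boundary C v0) (bv1 : boundary C v1)
  (v01 : b v0 v1 = 1).

(** The sum u = v_0 + v_1 is timelike and lies in C, so [cone_pairing] lets the sign of b u v tell C
    from C'. The single inequality b u v >= 0 is then split into one for v_0 and one for v_1. *)
Lemma half_coneP : [/\ b v0 v0 = 0, b v1 v1 = 0 &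
  forall v, C v <-> [/\ 0 <= b v v, 0 <= b v0 v & 0 <= b v1 v]].
Proof.
have [C' [kC kC' CC']] := hC.
have Cge x : C x -> 0 <= b x x.
  by move=> h; suff : (C `|` C') x by [rewrite CC']; left.
have sub x : boundary C x -> C x.
  by case=> + _; rewrite -(closure_id C).1 //; case: kC.
have [Cv0 Cv1] := (sub _ bv0, sub _ bv1).
pose u := v0 + v1.
have Cu : C u by have := kC.2 1 1 v0 v1 ler01 ler01 Cv0 Cv1; rewrite !scale1r.
have uu : b u u = b v0 v0 + b v1 v1 + 2.
  by rewrite !formE (formC b v1 v0) v01; ring.
have u0 : 0 < b u u.
  by rewrite uu ltr_wpDl ?ltr0n // addr_ge0 // Cge.
have CuE v : C v <-> 0 <= b v v /\ 0 <= b u v.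
  split=> [Cv|[vv uv]].
    by split; [exact: Cge|exact: (cone_pairing n2 hb kC kC' CC')].
  have [uv0|uv0] := eqVneq (b u v) 0.
    suff -> : v = 0 *: v0 + 0 *: v1 by apply: kC.2.
    rewrite !scale0r addr0; apply/eqP/negPn/negP => vn0.
    by have := timelike_orthogonal n2 hb u0 uv0 vn0; rewrite ltNge vv.
  have : (C `|` C') v by rewrite CC'.
  case=> // C'v; exfalso.
  have : (C `|` C') (- u) by rewrite CC' /= formNl formNr opprK ltW.
  case=> [CNu|C'Nu].
    have := cone_pairing n2 hb kC kC' CC' Cu CNu u0.
    by rewrite formNr leNgt oppr_lt0 u0.
  have := @cone_pairing _ _ _ n2 hb C' C (- u) v kC' kC _ C'Nu C'v.
  rewrite setUC => /(_ CC'); rewrite !formNl formNr opprK => /(_ u0).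
  by rewrite oppr_ge0 leNgt lt_neqAle eq_sym uv0 uv.
(* If b x x > 0, both inequalities defining C are strict at x, hence hold nearby, and x would be an
   interior point. *)
have null x : boundary C x -> 0 < b u x -> b x x = 0.
  move=> bx ux; apply/eqP/negPn/negP => xx; case: (bx) => _; apply.
  have xx0 : 0 < b x x by rewrite lt_neqAle eq_sym xx; apply/Cge/sub.
  have H1 : \forall y \near x, 0 < b u y.
    exact: (cvgr_gt _ (@form_continuous u x) _ ux).
  have H2 : \forall y \near x, 0 < b y y.
    exact: (cvgr_gt _ (@form_diag_continuous x) _ xx0).
  rewrite /interior; near=> y; apply/CuE; split; apply: ltW.
    by near: y.
  by near: y.
have n0 : b v0 v0 = 0.
  by apply: null => //; rewrite formDl (formC b v1) v01 ltr_wpDl // Cge.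
have n1 : b v1 v1 = 0.
  by apply: null => //; rewrite formDl v01 ltr_pwDl // Cge.
split=> // v; rewrite CuE.
(* The component of v orthogonal to v_0 and v_1. Since b w w <= 0, b v v >= 0 forces the product of
   b v_0 v and b v_1 v to be nonnegative. *)
pose w := v - b v1 v *: v0 - b v0 v *: v1.
have uw : b u w = 0.
  by rewrite !formE (formC b v1 v0) v01 n0 n1; ring.
have ww : b w w <= 0.
  have [->|w0] := eqVneq w 0; first by rewrite form0l.
  exact/ltW/(timelike_orthogonal n2 hb u0).
have vv : b v v = 2 * (b v0 v * b v1 v) + b w w.
  by rewrite /w !formE !(formC b v) (formC b v1 v0) v01 n0 n1; ring.
rewrite /u formDl; split=> -[h1].
  move=> h2; have : 0 <= b v0 v * b v1 v by lra.
  by move=> h3; have [] := nonneg_pair h2 h3.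
by move=> h2 h3; split=> //; lra.
Unshelve. all: by end_near.
Qed.

End HalfCone.

(** * Extending partial isometries by reflections *)

Section Isometries.
Variables (R : realType) (n n' : nat).
Variables (b : {symmetric 'rV[R]_n}) (b' : {symmetric 'rV[R]_n'}).
Hypotheses (n2 : (2 <= n')%N) (nn' : n = n').
Hypotheses (hb : lorentzian_form b) (hb' : lorentzian_form b').
Local Notation V := 'rV[R]_n.
Local Notation V' := 'rV[R]_n'.

Definition form_isometry (L : V -> V') := forall u v, b' (L u) (L v) = b u v.

Lemma lorentz_isometry : exists L : 'Hom(V, V'), form_isometry L.
Proof.
have [e [/andP[/eqP ef eF] eo]] := hb.
have [e' [_ eo']] := hb'.
pose c (i : 'I_n) := tnth e' (cast_ord nn' i).
exists (\sum_i linfun (fun v => coord e i v *: c i)) => u v.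
have vE w : w = \sum_i coord e i w *: tnth e i.
  under eq_bigr do rewrite (tnth_nth 0).
  by apply: coord_span; rewrite ef memvf.
have LE w : (\sum_i linfun (fun v => coord e i v *: c i)) w
    = \sum_i coord e i w *: c i.
  rewrite sum_lfunE; apply: eq_bigr => i _.
  have lin : linear (fun v => coord e i v *: c i).
    by move=> k x y; rewrite linearP scalerDl scalerA.
  pose f : {linear V -> V'} := HB.pack (fun v => coord e i v *: c i)
    (GRing.isLinear.Build _ _ _ _ _ lin).
  by rewrite (lfunE f).
rewrite !LE form_suml [in RHS](vE u) form_suml; apply: eq_bigr => i _.
rewrite !formZl; congr (_ * _).
rewrite form_sumr [in RHS](vE v) form_sumr; apply: eq_bigr => j _.
by rewrite !formZr; congr (_ * _); rewrite eo eo'.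
Qed.

Definition reflection (w v : V') : V' := v - (2 * b' w v / b' w w) *: w.

Lemma reflection_linear w : linear (reflection w).
Proof.
move=> k x y; rewrite /reflection !formE scalerBr scalerA [RHS]addrACA -opprD.
by rewrite -scalerDl; congr (_ - _ *: _); ring.
Qed.

Lemma reflection_isometry w u v : b' w w != 0 ->
  b' (reflection w u) (reflection w v) = b' u v.
Proof. by move=> w0; rewrite /reflection !formE (formC b' u w); field. Qed.

Lemma reflection_orth w v : b' w v = 0 -> reflection w v = v.
Proof. by move=> h; rewrite /reflection h mulr0 mul0r scale0r subr0. Qed.

Lemma reflection_sub u v : b' u u = b' v v -> b' (u - v) (u - v) != 0 ->
  reflection (u - v) u = v.
Proof.
move=> uv w0; rewrite /reflection (_ : _ / _ = 1) ?scale1r ?subKr //.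
rewrite -[RHS](divff w0); congr (_ / _).
by rewrite !formE (formC b' v u) -uv; ring.
Qed.

Lemma isometry_comp_reflection (L : 'Hom(V, V')) w : form_isometry L ->
  b' w w != 0 -> exists2 L' : 'Hom(V, V'), form_isometry L' &
    forall v, L' v = reflection w (L v).
Proof.
move=> hL w0.
pose f : {linear V' -> V'} := HB.pack (reflection w)
    (GRing.isLinear.Build _ _ _ _ _ (reflection_linear w)).
have LE v : (linfun f \o L)%VF v = reflection w (L v) by rewrite comp_lfunE lfunE.
by exists (linfun f \o L)%VF => // u v; rewrite !LE reflection_isometry.
Qed.

(* Each vector of the list is moved to its image by one more reflection, along
   a vector orthogonal to the images reached so far; only the first, timelike,
   vector may require -1. *)
Lemma lorentz_extension (p0 : V * V') (s : seq (V * V')) :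
  0 < b p0.1 p0.1 ->
  {in p0 :: s &, forall p q, b' p.2 q.2 = b p.1 q.1} ->
  exists2 L : 'Hom(V, V'), form_isometry L &
    {in p0 :: s, forall p, L p.1 = p.2}.
Proof.
move=> p0t; elim/last_ind: s => [|s p IH] hs.
  have [L hL] := lorentz_isometry.
  have pp : b' (L p0.1) (L p0.1) = b' p0.2 p0.2.
    by rewrite hL hs ?mem_head.
  have [d0|d0] := eqVneq (b' (L p0.1 - p0.2) (L p0.1 - p0.2)) 0; last first.
    have [L' hL' LE] := isometry_comp_reflection hL d0.
    by exists L' => // q; rewrite inE => /eqP->; rewrite LE reflection_sub.
  (* When the difference is null, the parallelogram identity gives the sum four times the norm of
     [p0.2], which is positive; so [L p0.1] can be reflected to [- p0.2]. *)
  have s0 : b' (L p0.1 - - p0.2) (L p0.1 - - p0.2) != 0.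
    rewrite gt_eqF //; have <- : 4 * b' p0.2 p0.2 = b' (L p0.1 - - p0.2) (L p0.1 - - p0.2).
      rewrite -[RHS]addr0 -d0 !formE pp; ring.
    by rewrite -pp hL mulr_gt0.
  have [L' hL' LE] := isometry_comp_reflection hL s0.
  exists (- L')%VF; first by move=> u v; rewrite !opp_lfunE !formE opprK.
  move=> q; rewrite inE => /eqP->; rewrite opp_lfunE LE reflection_sub ?opprK //.
    by rewrite formNl formNr opprK.
  by move: s0; rewrite opprK.
have [|L hL LE] := IH.
  by move=> q r qs rs; apply: hs; rewrite -rcons_cons mem_rcons inE ?qs ?rs orbT.
have ps : p \in p0 :: rcons s p by rewrite -rcons_cons mem_rcons mem_head.
have os q : q \in p0 :: s -> b' (L p.1 - p.2) q.2 = 0.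
  move=> qs; rewrite formDl formNl -{1}(LE _ qs) hL hs ?subrr //.
  by rewrite -rcons_cons mem_rcons inE qs orbT.
have [d0|d0] := eqVneq (L p.1 - p.2) 0.
  exists L => // q; rewrite -rcons_cons mem_rcons inE => /orP[/eqP->|/LE//].
  by apply/eqP; rewrite -subr_eq0 d0.
have p0t' : 0 < b' p0.2 p0.2 by rewrite hs ?mem_head.
have /(timelike_orthogonal n2 hb' p0t')/(_ d0) dlt : b' p0.2 (L p.1 - p.2) = 0.
  by rewrite formC os ?mem_head.
have [|L' hL' L'E] := @isometry_comp_reflection L (L p.1 - p.2) hL.
  by rewrite lt_eqF.
exists L' => // q; rewrite -rcons_cons mem_rcons inE => /orP[/eqP->|qs].
  by rewrite L'E reflection_sub ?(lt_eqF dlt) // hL hs.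
by rewrite L'E LE // reflection_orth // os.
Qed.

End Isometries.

(** * Mean values and the symmetry of mixed derivatives *)

Section DirectionalDerivatives.
Variables (R : realType) (V W : normedModType R).
Implicit Types (F : V -> W) (p v : V).

Lemma is_derive_cvg F p v df : is_derive p v F df ->
  (fun h : R => h^-1 *: (F (h *: v + p) - F p)) @ 0^' --> df.
Proof. by case=> dF <-; exact: dF. Qed.

Lemma cvg_is_derive F p v df :
  (fun h : R => h^-1 *: (F (h *: v + p) - F p)) @ 0^' --> df ->
  is_derive p v F df.
Proof.
move=> H; split; first by apply/cvg_ex; exists df; exact: H.
by apply: etrans (cvg_lim _ H) _.
Qed.

End DirectionalDerivatives.

Lemma is_derive_line (R : realType) (V W : normedModType R) (F : V -> W) p v (t : R) df :
  is_derive (p + t *: v) v F df ->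
  is_derive t 1 (fun s : R => F (p + s *: v)) df.
Proof.
move/is_derive_cvg => H; apply: cvg_is_derive.
suff <- : (fun h : R => h^-1 *: (F (h *: v + (p + t *: v)) - F (p + t *: v))) =
  (fun h : R => h^-1 *: (F (p + (h *: 1 + t) *: v) - F (p + t *: v))) by [].
apply/funext => h; congr (_ *: (F _ - _)).
by rewrite scalerDl /GRing.scale /= mulr1 addrCA.
Qed.

Lemma is_derive_linear (R : realType) (V W W' : normedModType R)
    (L : {linear W -> W'}) (F : V -> W) p v df :
  continuous L -> is_derive p v F df -> is_derive p v (L \o F) (L df).
Proof.
move=> cL /is_derive_cvg H; apply: cvg_is_derive.
have -> : (fun h : R => h^-1 *: ((L \o F) (h *: v + p) - (L \o F) p)) =
  L \o (fun h : R => h^-1 *: (F (h *: v + p) - F p)).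
  by apply/funext => h; rewrite /comp (linearZ_LR L) (linearB L).
exact: cvg_comp H (cL df).
Qed.

Lemma dist_halves (R : realType) (x y z e : R) :
  `|x - z| < e / 2 -> `|y - z| < e / 2 -> `|x - y| <= e.
Proof.
move=> xz yz; rewrite (_ : x - y = (x - z) - (y - z)); last by ring.
by apply/ltW/(le_lt_trans (ler_normB _ _)); rewrite [ltRHS]splitr ltrD.
Qed.

Section MeanValue.
Variables (R : realType) (V : normedModType R) (m : nat).
Local Notation W := 'rV[R]_m.
Implicit Types (F : V -> W) (p x y : V).

Lemma mean_value_coord F p v (s : R) (j : 'I_m) : 0 <= s ->
  (forall t, 0 <= t <= s -> derivable F (p + t *: v) v) ->
  exists2 c, 0 <= c <= s &
    (F (p + s *: v) - F p) ord0 j = s * ('D_v F (p + c *: v)) ord0 j.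
Proof.
move=> s0 dF.
pose coordj (w : W) : R^o := w ord0 j.
have lin : linear coordj by move=> k u w; rewrite /coordj !mxE.
pose L : {linear W -> R^o} := HB.pack coordj (GRing.isLinear.Build _ _ _ _ _ lin).
pose phi t := L (F (p + t *: v)).
have dphi t : 0 <= t <= s -> is_derive t 1 phi (L ('D_v F (p + t *: v))).
  move=> ht; apply: (@is_derive_line _ _ _ (L \o F)).
  by apply: is_derive_linear; [exact: linear_rV_continuous|exact/derivableP/dF].
have [t||c hc] := @MVT_segment R phi (fun t => L ('D_v F (p + t *: v))) 0 s s0.
- by rewrite in_itv /= => /andP[h1 h2]; apply: dphi; rewrite !ltW.
- apply: derivable_within_continuous => t; rewrite in_itv /= => /dphi [h _].
  exact: h.
rewrite in_itv /= in hc; rewrite subr0 => E; exists c => //.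
have -> : (F (p + s *: v) - F p) ord0 j = phi s - phi 0.
  by rewrite /phi scale0r addr0 /L /= /coordj !mxE.
by rewrite E mulrC.
Qed.

Lemma constant_of_derive0 F p v :
  (forall t, 0 <= t <= 1 -> is_derive (p + t *: v) v F 0) -> F (p + v) = F p.
Proof.
move=> dF; apply/rowP => j; apply/eqP; rewrite -subr_eq0.
have [t /dF[]//|c hc] := @mean_value_coord F p v 1 j ler01.
rewrite scale1r !mxE => ->; have [_ ->] := dF _ hc.
by rewrite mxE mulr0.
Qed.

Definition second_difference F p x y := F (p + x + y) - F (p + x) - (F (p + y) - F p).

(** Two mean value steps: the increment F(q + s y) - F(q) is followed along x, then D_x F along
    y. *)
Lemma second_difference_mean_value F p x y (s : R) (j : 'I_m) : 0 <= s ->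
  (forall c d, 0 <= c <= s -> 0 <= d <= s ->
     derivable F (p + c *: x + d *: y) x /\
     derivable (fun q => 'D_x F q) (p + c *: x + d *: y) y) ->
  exists c d, [/\ 0 <= c <= s, 0 <= d <= s &
    (second_difference F p (s *: x) (s *: y)) ord0 j =
      s ^+ 2 * ('D_y (fun q => 'D_x F q) (p + c *: x + d *: y)) ord0 j].
Proof.
move=> s0 dF; have s00 : 0 <= (0 : R) <= s by rewrite lexx.
have ss : 0 <= s <= s by rewrite s0 lexx.
pose G q := F (q + s *: y) - F q.
have dG c : 0 <= c <= s ->
    is_derive (p + c *: x) x G ('D_x F (p + c *: x + s *: y) - 'D_x F (p + c *: x)).
  move=> hc; apply: is_deriveB.
    have [/derivableP/is_derive_cvg H _] := dF c s hc ss.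
    by apply: cvg_is_derive; under eq_fun do rewrite -addrA.
  by have [/derivableP] := dF c 0 hc s00; rewrite scale0r addr0.
have [t /dG[]//|c hc] := @mean_value_coord G p x s j s0.
have [_ ->] := dG _ hc.
have [t /(dF _ _ hc)[]//|d hd -> E] :=
  @mean_value_coord (fun q => 'D_x F q) (p + c *: x) y s j s0.
exists c, d; split => //; rewrite /second_difference.
by move: E; rewrite /G expr2 -mulrA.
Qed.

(** The second difference is symmetric in x and y. Divided by s^2, each of its coordinates is a
    value of either mixed derivative at a point of a small parallelogram, and continuity at p
    identifies the two. *)
Lemma schwarz F (U : set V) p x y : open U -> U p ->
  (forall q, U q -> derivable F q x /\ derivable F q y) ->
  (forall q, U q -> derivable (fun q => 'D_x F q) q y /\
                    derivable (fun q => 'D_y F q) q x) ->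
  {for p, continuous (fun q => 'D_y (fun q => 'D_x F q) q)} ->
  {for p, continuous (fun q => 'D_x (fun q => 'D_y F q) q)} ->
  'D_y (fun q => 'D_x F q) p = 'D_x (fun q => 'D_y F q) p.
Proof.
move=> oU Up d1 d2 c1 c2; apply/rowP => j.
pose A : V -> W := 'D_y ('D_x F); pose B : V -> W := 'D_x ('D_y F).
rewrite -[LHS]/(A p ord0 j) -[RHS]/(B p ord0 j).
apply/eqP; rewrite -subr_eq0 -normr_le0; apply/ler_addgt0Pr => e e0.
rewrite add0r.
have e20 : 0 < e / 2 by rewrite divr_gt0.
have near_coord (G : V -> W) : {for p, continuous G} ->
    \forall q \near p, `|G p ord0 j - G q ord0 j| < e / 2.
  move=> cG; have cGj : G q ord0 j @[q --> p] --> G p ord0 j.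
    exact: (cvg_comp _ _ cG (@coord_continuous _ _ _ ord0 j (G p))).
  by move/cvgrPdist_lt : cGj; apply.
have N1 := near_coord A c1; have N2 := near_coord B c2.
have N : \forall q \near p, [/\ U q, `|A p ord0 j - A q ord0 j| < e / 2 &
    `|B p ord0 j - B q ord0 j| < e / 2].
  by apply: filterS3 (open_nbhs_nbhs (conj oU Up)) N1 N2.
have /nbhs_ballP[r /= r0 hr] := N.
(* This keeps the whole parallelogram within r / 2 of p; the summand 1 makes the denominator
   positive even for x = y = 0. *)
pose s := r / (2 * (`|x| + `|y| + 1)).
have K0 : 0 < `|x| + `|y| + 1 by rewrite ltr_wpDl ?addr_ge0.
have s0 : 0 < s by rewrite divr_gt0 // mulr_gt0.
have inb c d : 0 <= c <= s -> 0 <= d <= s -> ball p r (p + c *: x + d *: y).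
  move=> /andP[c0 cs] /andP[dd0 ds]; rewrite -ball_normE /= -addrA opprD addrA subrr.
  rewrite sub0r normrN; apply: le_lt_trans (ler_normD _ _) _.
  rewrite !normrZ !ger0_norm //.
  apply: le_lt_trans (_ : s * (`|x| + `|y|) < _).
    by rewrite mulrDr lerD // ler_wpM2r.
  apply: le_lt_trans (_ : s * (`|x| + `|y| + 1) < _).
    by rewrite ler_wpM2l ?ltW // ltrDl.
  by rewrite /s invfM mulrA mulfVK ?gt_eqF // gtr_pMr // invf_lt1 // ltr1n.
have hA : forall c d, 0 <= c <= s -> 0 <= d <= s ->
    derivable F (p + c *: x + d *: y) x /\
    derivable (fun q => 'D_x F q) (p + c *: x + d *: y) y.
  move=> c d hc hd; have [Uq _ _] := hr _ (inb c d hc hd).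
  by split; [exact: (d1 _ Uq).1|exact: (d2 _ Uq).1].
have hB : forall c d, 0 <= c <= s -> 0 <= d <= s ->
    derivable F (p + c *: y + d *: x) y /\
    derivable (fun q => 'D_y F q) (p + c *: y + d *: x) x.
  move=> c d hc hd; have [Uq _ _] := hr _ (inb d c hd hc).
  by rewrite addrAC; split; [exact: (d1 _ Uq).2|exact: (d2 _ Uq).2].
have [c [d [hc hd E1]]] := second_difference_mean_value j (ltW s0) hA.
have [c' [d' [hc' hd' E2]]] := second_difference_mean_value j (ltW s0) hB.
have sd : second_difference F p (s *: x) (s *: y) = second_difference F p (s *: y) (s *: x).
  rewrite /second_difference (addrAC p (s *: x)) !opprB ![_ + (F p - _)]addrCA.
  by congr (_ + _); exact: addrAC.
have {E1 E2}E : A (p + c *: x + d *: y) ord0 j = B (p + d' *: x + c' *: y) ord0 j.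
  have s2 : s ^+ 2 != 0 by rewrite expf_neq0 // gt_eqF.
  rewrite (addrAC p (c' *: y)) in E2; apply: (mulfI s2).
  exact: etrans (esym E1) (etrans (congr1 (fun w : W => w ord0 j) sd) E2).
have [_ NA _] := hr _ (inb c d hc hd); have [_ _ NB] := hr _ (inb d' c' hd' hc').
exact: dist_halves NA (eq_ind_r (fun z => `|B p ord0 j - z| < e / 2) NB E).
Qed.

End MeanValue.

(** * Locality and stability of differentiability and smoothness *)

Section NearDifferentiable.
Variables (R : realType) (V W : normedModType R).
Implicit Types (F G : V -> W) (x : V).

Lemma near0_differentiable G x : (\forall y \near x, G y = 0) -> differentiable G x.
Proof.
move=> G0; apply/diffP => /=.
(* The differential is defined by choice, so a candidate has to be exhibited: the zero map, whose
   remainder vanishes near x. *)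
apply: (@getPex _ (fun (df : {linear V -> W}) => continuous df /\
  forall y, G y = G (lim (nbhs x)) + df (y - lim (nbhs x))
                  +o_(y \near x) (y - lim (nbhs x)))).
pose z : {linear V -> W} := \0.
exists z => /=; split; first by move=> y; exact: cvg_cst.
suff H : G = (fun y => G (lim (nbhs x)) + z (y - lim (nbhs x))) +o_ (nbhs x)
    (fun y => y - lim (nbhs x)) by move: H; rewrite funeqE.
apply/eqaddoP => _/posnumP[e]; near=> y.
have Gy : G y = 0 by near: y.
rewrite lim_id // !fctE Gy (nbhs_singleton G0).
by rewrite [z _](_ : _ = 0) // addr0 subr0 normr0 mulr_ge0.
Unshelve. all: by end_near.
Qed.

Lemma near_eq_differentiable F G x : (\forall y \near x, F y = G y) ->
  differentiable F x -> differentiable G x.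
Proof.
move=> FG dF; rewrite (_ : G = F + (G - F)); last by rewrite addrC subrK.
apply: differentiableD => //; apply: near0_differentiable.
by near=> y; rewrite !fctE (near FG) ?subrr.
Unshelve. all: by end_near.
Qed.

Lemma near_eq_diff F G x v : (\forall y \near x, F y = G y) ->
  differentiable F x -> 'd F x v = 'd G x v.
Proof.
move=> FG dF; rewrite -!deriveE //; last exact: near_eq_differentiable dF.
exact: near_eq_derive.
Qed.

End NearDifferentiable.

Section Smoothness.
Variables (R : realType) (V W : normedModType R).
Implicit Types (F G : V -> W) (U : set V).

Lemma Ck_ext k U F G : open U -> {in U, F =1 G} -> Ck k U F -> Ck k U G.
Proof.
move=> oU; elim: k F G => [|k IH] F G FG /=.
  move=> cF x Ux; have FGx : \forall y \near x, F y = G y.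
    by apply: filterS (open_nbhs_nbhs (conj oU Ux)) => y Uy; apply: FG; apply/mem_set.
  apply: cvg_trans (near_eq_cvg FGx) _.
  by rewrite -(nbhs_singleton FGx); exact: cF.
have FGn x : U x -> \forall y \near x, F y = G y.
  move=> Ux; apply: filterS (open_nbhs_nbhs (conj oU Ux)) => y Uy.
  by apply: FG; apply/mem_set.
case=> dF hF; split=> [x Ux|v].
  exact: near_eq_differentiable (FGn x Ux) (dF x Ux).
apply: IH (hF v) => x /set_mem Ux.
by apply: near_eq_derive; exact: FGn.
Qed.

Lemma Ck_cst k U (w : W) : Ck k U (fun _ => w).
Proof.
elim: k w => [|k IH] w /=; first by move=> x _; exact: cvg_cst.
split=> [x _|v]; first exact: differentiable_cst.
apply: (eq_ind_r (Ck k U) (IH 0)); apply/funext => x; exact: derive_cst.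
Qed.

End Smoothness.

Lemma Ck_linear_comp (R : realType) (V W W' : normedModType R)
    (L : {linear W -> W'}) k (U : set V) (F : V -> W) :
  continuous L -> open U -> Ck k U F -> Ck k U (L \o F).
Proof.
move=> cL oU; elim: k F => [|k IH] F /=.
  by move=> cF x Ux; apply: (cvg_comp _ _ (cF x Ux)); exact: cL.
case=> dF hF; split=> [x Ux|v].
  apply: differentiable_comp; first exact: dF.
  exact: linear_differentiable.
apply: (Ck_ext oU _ (IH _ (hF v))) => x /set_mem Ux /=; apply/esym.
have /derivableP h : derivable F x v by apply: diff_derivable; exact: dF.
by have [_ ->] := is_derive_linear cL h.
Qed.

(** A constant cancels in the difference quotients, so the directional derivatives agree as
    functions on all of V and a case distinction on k replaces induction. *)
Lemma Ck_shift (R : realType) (V W : normedModType R) k (U : set V) (F : V -> W) w :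
  Ck k U F -> Ck k U (fun x => F x + w).
Proof.
case: k => [|k] /=.
  by move=> cF x Ux; apply: cvgD; [exact: cF|exact: cvg_cst].
case=> dF hF; split=> [x Ux|v].
  by apply: differentiableD; [exact: dF|exact: differentiable_cst].
apply: (eq_ind_r (Ck k U) (hF v)); apply/funext => x.
have E : (fun h : R => h^-1 *: (((fun x => F x + w) \o shift x) (h *: v) - (F x + w)))
    = (fun h : R => h^-1 *: ((F \o shift x) (h *: v) - F x)).
  by apply/funext => h /=; rewrite opprD addrACA subrr addr0.
by rewrite /derive E.
Qed.

Lemma Ck_id (R : realType) (V : normedModType R) k (U : set V) : Ck k U id.
Proof.
case: k => [|k] /=; first by move=> x _; exact: cvg_id.
split=> [x _|v]; first exact: ex_diff.
apply: (eq_ind_r (Ck k U) (Ck_cst k U v)); apply/funext => x; exact: derive_id.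
Qed.

Lemma smooth_affine_comp (R : realType) (V : normedModType R) (n n' : nat)
    (L : {linear 'rV[R]_n -> 'rV[R]_n'}) w (U : set V) (F : V -> 'rV[R]_n) :
  open U -> smooth_on U F -> smooth_on U (fun x => L (F x) + w).
Proof.
move=> oU sF k; apply: (@Ck_shift _ _ _ _ _ (L \o F)).
by apply: Ck_linear_comp => //; exact: linear_rV_continuous.
Qed.

Lemma smooth_id (R : realType) (V : normedModType R) (U : set V) : smooth_on U id.
Proof. by move=> k; exact: Ck_id. Qed.

Lemma is_derive_form (R : realType) (V : normedModType R) (n : nat)
    (b : {symmetric 'rV[R]_n}) (F G : V -> 'rV[R]_n) p v df dg :
  is_derive p v F df -> is_derive p v G dg ->
  is_derive p v (fun q => b (F q) (G q) : R^o) (b df (G p) + b (F p) dg).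
Proof.
move=> hF hG.
have is_derive_coord (i : 'I_n) : is_derive p v (fun q => F q ord0 i : R^o) (df ord0 i).
  pose c (w : 'rV[R]_n) : R^o := w ord0 i.
  have lin : linear c by move=> k u w; rewrite /c !mxE.
  pose L : {linear 'rV[R]_n -> R^o} := HB.pack c (GRing.isLinear.Build _ _ _ _ _ lin).
  exact: (is_derive_linear (@linear_rV_continuous _ _ _ L) hF).
have is_derive_pairing u : is_derive p v (fun q => b u (G q) : R^o) (b u dg).
  have lin : linear (b u : 'rV[R]_n -> R^o) by move=> c x y; rewrite formDr formZr.
  pose L : {linear 'rV[R]_n -> R^o} := HB.pack (b u : 'rV[R]_n -> R^o)
    (GRing.isLinear.Build _ _ _ _ _ lin).
  exact: (is_derive_linear (@linear_rV_continuous _ _ _ L) hG).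
pose f i : V -> R^o := fun q => F q ord0 i : R^o.
pose g i : V -> R^o := fun q => b (delta_mx ord0 i) (G q) : R^o.
have bE u w : b u w = \sum_i u ord0 i * b (delta_mx ord0 i) w.
  rewrite {1}(row_sum_delta u) form_suml; apply: eq_bigr => i _.
  by rewrite formZl.
have -> : (fun q => b (F q) (G q) : R^o) = \sum_i (f i * g i).
  by apply/funext => q; rewrite bE fct_sumE.
have -> : b df (G p) + b (F p) dg =
    \sum_i (f i p *: b (delta_mx ord0 i) dg + g i p *: df ord0 i).
  rewrite !bE addrC -big_split /=; apply: eq_bigr => i _; congr (_ + _).
  exact: mulrC.
by apply: is_derive_sum => i; apply: is_deriveM.
Qed.

(** * Local isometries are affine *)

Section LocalIsometry.
Variables (R : realType) (n n' : nat).
Variables (b : {symmetric 'rV[R]_n}) (b' : {symmetric 'rV[R]_n'}).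
Hypotheses (nn' : (n' <= n)%N).
Hypothesis bnd : forall v, (forall w, b v w = 0) -> v = 0.
Hypothesis bnd' : forall v, (forall w, b' v w = 0) -> v = 0.
Local Notation V := 'rV[R]_n.
Local Notation V' := 'rV[R]_n'.

Lemma form_isometry_inj (L : {linear V -> V'}) : form_isometry b b' L -> injective L.
Proof.
move=> hL u v Luv; apply/eqP; rewrite -subr_eq0; apply/eqP/bnd => w.
by rewrite -hL linearB Luv subrr form0l.
Qed.

Lemma form_isometry_surj (L : {linear V -> V'}) : form_isometry b b' L ->
  forall w, exists v, L v = w.
Proof.
move=> hL w.
have k0 : lker (linfun L) = 0%VS.
  apply/eqP; rewrite -subv0; apply/subvP => v; rewrite memv_ker lfunE /= memv0.
  by move=> /eqP Lv; apply/eqP/(form_isometry_inj hL); rewrite Lv linear0.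
have lf : limg (linfun L) = fullv.
  apply/eqP; rewrite eqEdim subvf /= dimvf.
  have := limg_ker_dim (linfun L) fullv.
  by rewrite k0 capv0 dimv0 add0n => ->; rewrite dimvf /dim /= !mul1n.
have : w \in limg (linfun L) by rewrite lf memvf.
by case/memv_imgP => v _ ->; exists v; rewrite lfunE.
Qed.

Variables (U : set V) (F : V -> V').
Hypotheses (oU : open U) (sF : Ck 2 U F).
Hypothesis isoF : forall v, U v -> form_isometry b b' ('d F v).

(* The form b'(D_z D_x F, D_y F) is symmetric in x, z and, by differentiating
   b'(D_x F, D_y F) = b(x, y), skew in x, y; hence it vanishes. *)
Lemma local_isometry_second_derivative x z q : U q -> 'D_z ('D_x F) q = 0.
Proof.
move=> Uq.
have [dF /= h] := sF.
have dD v p : U p -> differentiable ('D_v F) p by case: (h v) => + _; apply.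
have cD v w p : U p -> {for p, continuous ('D_w ('D_v F))}.
  by case: (h v) => _; apply.
have DE v p : U p -> 'D_v F p = 'd F p v by move=> Up; rewrite deriveE //; exact: dF.
pose T x y z := b' ('D_z ('D_x F) q) ('D_y F q).
have Tsym u v w : T u v w = T w v u.
  have H : 'D_w ('D_u F) q = 'D_u ('D_w F) q.
    apply: (schwarz oU Uq); [| |exact: cD|exact: cD] => p Up.
      by split; apply: diff_derivable; exact: dF.
    by split; apply: diff_derivable; exact: dD.
  exact: (congr1 (fun x => b' x ('D_v F q)) H).
have Tskew u v w : T u v w = - T v u w.
  apply/eqP; rewrite -addr_eq0; apply/eqP.
  have d1 : is_derive q w ('D_u F) ('D_w ('D_u F) q).
    by apply: derivableP; apply: diff_derivable; exact: dD.
  have d2 : is_derive q w ('D_v F) ('D_w ('D_v F) q).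
    by apply: derivableP; apply: diff_derivable; exact: dD.
  have [_ E1] := is_derive_form b' d1 d2.
  have E2 : 'D_w (fun p => b' ('D_u F p) ('D_v F p) : R^o) q = 0.
    apply: etrans (derive_cst (b u v : R^o) q w).
    apply: near_eq_derive; apply: filterS (open_nbhs_nbhs (conj oU Uq)) => p Up.
    by rewrite !DE // isoF.
  have E3 : T v u w = b' ('D_u F q) ('D_w ('D_v F) q) by exact: formC.
  by rewrite E3; exact: etrans (esym E1) E2.
have T0 u v w : T u v w = 0.
  have : T u v w = - T u v w.
    rewrite {1}Tsym Tskew Tsym Tskew opprK Tsym Tskew; congr (- _).
  by move=> E; lra.
apply: bnd' => w; have [y yw] := form_isometry_surj (isoF Uq) w.
by rewrite -yw -DE //; exact: T0.
Qed.

Lemma local_isometry_affine p : U p ->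
  \forall v \near p, F v = F p + 'd F p (v - p).
Proof.
move=> Up; have [dF /= h] := sF.
have dD v q : U q -> differentiable ('D_v F) q by case: (h v) => + _; apply.
have DE v q : U q -> 'D_v F q = 'd F q v by move=> Uq; rewrite deriveE //; exact: dF.
have /nbhs_ballP[e /= e0 he] := open_nbhs_nbhs (conj oU Up).
have seg q t : ball p e q -> 0 <= t <= 1 -> ball p e (p + t *: (q - p)).
  rewrite -!ball_normE /= => pq /andP[t0 t1].
  rewrite opprD addrA subrr sub0r normrN normrZ ger0_norm //.
  by apply: le_lt_trans pq; rewrite distrC ler_piMl.
have Dconst v q : ball p e q -> 'D_v F q = 'D_v F p.
  move=> pq; have := @constant_of_derive0 _ _ _ ('D_v F) p (q - p).
  rewrite (addrC p) subrK; apply => t ht.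
  have Ut := he _ (seg _ _ pq ht).
  split; first by apply: diff_derivable; exact: dD.
  exact: local_isometry_second_derivative.
apply/nbhs_ballP; exists e => //= q pq.
pose G v := F v - 'd F p v.
have : G (p + (q - p)) = G p.
  apply: constant_of_derive0 => t ht; have bt := seg _ _ pq ht.
  rewrite -(subrr ('D_(q - p) F p)) -{1}(Dconst _ _ bt) (DE _ p) //.
  apply: is_deriveB.
    by apply: derivableP; apply: diff_derivable; apply: dF; exact: he.
  have cdf : continuous ('d F p) by exact: linear_rV_continuous.
  exact: (is_derive_linear cdf (is_derive_id _ _)).
rewrite (addrC p) subrK /G => E; rewrite linearB.
by move/eqP: E; rewrite subr_eq => /eqP ->; rewrite addrAC addrA.
Qed.

End LocalIsometry.

Section Realization.
Variables (R : realType) (M : realization R).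
Local Notation V := 'rV[R]_(dimV M).
Local Notation T := (subvs_of (spaceT M)).
Local Notation l := (ell M).
Local Notation a := (mapa M).
Local Notation v0 := (v0 M).
Local Notation v1 := (v1 M).
Implicit Types (v w : V) (x y : T) (s : R).

Let halfcone := half_coneP (dimV_ge2 M) (ell_lorentzian M) (coneP M)
  (v0_boundary M) (v1_boundary M) (ell_v0v1 M).

Lemma l00 : l v0 v0 = 0. Proof. by case: halfcone. Qed.
Lemma l11 : l v1 v1 = 0. Proof. by case: halfcone. Qed.
Lemma l01 : l v0 v1 = 1. Proof. exact: ell_v0v1. Qed.
Lemma l10 : l v1 v0 = 1. Proof. by rewrite formC l01. Qed.

Lemma coneE v : cone M v <-> [/\ 0 <= l v v, 0 <= l v0 v & 0 <= l v1 v].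
Proof. by case: halfcone => _ _; apply. Qed.

Lemma spaceNP v : reflect (l v0 v = 0 /\ l v1 v = 0) (v \in spaceN M).
Proof.
rewrite memv_cap !mem_orthov1 (formC l v v0) (formC l v v1).
by apply: (iffP andP) => -[/eqP ? /eqP].
Qed.

Lemma spaceN_negative v : v \in spaceN M -> v != 0 -> l v v < 0.
Proof.
move=> /spaceNP[v0v v1v] vn0.
apply: (timelike_orthogonal (dimV_ge2 M) (ell_lorentzian M) (u := v0 + v1)) => //.
  by rewrite !formE l00 l11 l01 l10 add0r addr0 addr_gt0.
by rewrite formDl v0v v1v addr0.
Qed.

Lemma spaceT_N x : vsval x \in spaceN M.
Proof. by apply: (subvP (spaceT_sub M)); exact: subvsP. Qed.
Lemma mapa_N x : a x \in spaceN M.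
Proof. by apply: (subvP (mapa_sub M)); exact: memv_img (memvf x). Qed.

Lemma l0T x : l v0 (vsval x) = 0. Proof. by case/spaceNP: (spaceT_N x). Qed.
Lemma l1T x : l v1 (vsval x) = 0. Proof. by case/spaceNP: (spaceT_N x). Qed.
Lemma l0a x : l v0 (a x) = 0. Proof. by case/spaceNP: (mapa_N x). Qed.
Lemma l1a x : l v1 (a x) = 0. Proof. by case/spaceNP: (mapa_N x). Qed.
Lemma lT0 x : l (vsval x) v0 = 0. Proof. by rewrite formC l0T. Qed.
Lemma la0 x : l (a x) v0 = 0. Proof. by rewrite formC l0a. Qed.
Definition lE := (l00, l11, l01, l10, l0T, l1T, l0a, l1a, lT0, la0).

Definition pencil s : 'Hom(T, V) := (linfun vsval + s *: a)%VF.

Lemma pencilE s x : pencil s x = vsval x + s *: a x.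
Proof. by rewrite add_lfunE scale_lfunE lfunE. Qed.

Lemma pencil_inj s : injective (pencil s).
Proof.
move=> x y E; apply/eqP; rewrite -subr_eq0; apply/eqP/(@mapa_ker _ M s).
by rewrite -pencilE (linearB (pencil s)) /= E subrr.
Qed.

Lemma qformE s x : qform s x = - l (pencil s x) (pencil s x).
Proof. by rewrite pencilE. Qed.

Definition v0_shift x v : R :=
  l (a x) v + 2^-1 * l0 v * l (a x) (a x) + 2^-1 * l (a x) (vsval x).

Lemma gammaE x v : gamma x v = v + pencil (l0 v) x - v0_shift x v *: v0.
Proof.
by rewrite /gamma /lambda /tau pencilE /v0_shift; apply/rowP => i; rewrite !mxE; ring.
Qed.

Lemma l0_pencil s x : l v0 (pencil s x) = 0.
Proof. by rewrite pencilE !formE !lE mulr0 addr0. Qed.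
Lemma l1_pencil s x : l v1 (pencil s x) = 0.
Proof. by rewrite pencilE !formE !lE mulr0 addr0. Qed.

Lemma l0_gamma x v : l0 (gamma x v) = l0 v.
Proof. by rewrite gammaE /l0 !formE l0_pencil l00 mulr0 oppr0 !addr0. Qed.

Lemma gamma0 v : gamma 0 v = v.
Proof.
by rewrite gammaE /v0_shift !linear0 !form0l !mulr0 !addr0 scale0r subr0.
Qed.

Lemma gammaD x y v : gamma x (gamma y v) = gamma (x + y) v.
Proof.
rewrite (gammaE x) l0_gamma !gammaE (linearD (pencil _)).
have symyx : l (a y) (vsval x) = l (a x) (vsval y) by rewrite mapa_sym formC.
have -> : v0_shift x (v + pencil (l0 v) y - v0_shift y v *: v0) =
    v0_shift (x + y) v - v0_shift y v.
  rewrite {1 2}/v0_shift -(gammaE y) l0_gamma gammaE pencilE /v0_shift.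
  rewrite !(linearD a) !(linearD vsval) !formE !lE symyx (formC l (a y) (a x)).
  by field.
by apply/rowP => i; rewrite !mxE; ring.
Qed.

Lemma gamma_inj x y v : gamma x v = gamma y v -> x = y.
Proof.
rewrite !gammaE => E; apply: (@pencil_inj (l0 v)).
have l1E z : l v1 (gamma z v) = l v1 v - v0_shift z v.
  by rewrite gammaE !formE l1_pencil l10 mulr1 addr0.
have sh : v0_shift x v = v0_shift y v.
  apply/oppr_inj/(addrI (l v1 v)); rewrite -!l1E !gammaE; congr (l _ _); exact: E.
by apply: (addrI v); apply: (addIr (- (v0_shift x v *: v0))); rewrite {2}sh.
Qed.

Lemma lambda_linear x : linear (lambda x).
Proof.
by move=> c u v; rewrite /lambda /l0 !formE; apply/rowP => i; rewrite !mxE; ring.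
Qed.

Lemma lambda_isometry x u v : l (lambda x u) (lambda x v) = l u v.
Proof.
by rewrite /lambda /l0 !formE !lE (formC l u (a x)) (formC l u v0); field.
Qed.

Lemma orbit_gamma x v : Gamma M x -> orbit (gamma x v) = orbit v.
Proof.
move=> Gx; apply/seteqP; split=> _ [y Gy <-].
  exists (y - (- x)); last by rewrite gammaD opprK.
  by apply: GammaB => //; rewrite -sub0r; apply: GammaB => //; exact: Gamma0.
by exists (y - x); [exact: GammaB|rewrite gammaD subrK].
Qed.

Lemma projP v w : proj v = proj w <-> exists2 x, Gamma M x & v = gamma x w.
Proof.
split=> [[E]|[x Gx ->]].
  have : orbit v v by exists 0; [exact: Gamma0|exact: gamma0].
  by rewrite E => -[x Gx xE]; exists x.
by apply: eq_exist; exact: orbit_gamma.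
Qed.

Lemma proj_surj (A : manifold M) : exists v, A = proj v.
Proof.
by case: A => A p; have [v _ E] := p; exists v; apply: eq_exist.
Qed.

Lemma lattice_gap : exists2 e : R, 0 < e &
  forall x, Gamma M x -> `|vsval x| < e -> x = 0.
Proof.
have /(@Gamma_discrete _ M)[_ [U /nbhs_ballP[e /= e0 eU] UE]] :
  (vsval @` Gamma M) 0 by exists 0; [exact: Gamma0|].
exists e => // x Gx xe.
have : (U `&` vsval @` Gamma M) (vsval x).
  split; last by exists x.
  by apply: eU; rewrite -ball_normE /= sub0r normrN.
by rewrite UE => /= E; apply: val_inj.
Qed.

Lemma pencil_bound s0 : exists K : R, \forall s \near s0, forall x,
  `|vsval x| <= K * `|pencil s x|.
Proof.
have k0 : lker (pencil s0) == 0%VS by apply/lker0P; exact: pencil_inj.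
have bound (f : T -> V) : linear f ->
    exists2 k, 0 < k & forall x, `|f x| <= k * `|pencil s0 x|.
  move=> lin; have lin' : linear (fun v => f (((pencil s0)^-1)%VF v)).
    by move=> c u v; rewrite linearP lin.
  pose L : {linear V -> V} := HB.pack (fun v => f (((pencil s0)^-1)%VF v))
    (GRing.isLinear.Build _ _ _ _ _ lin').
  have [k k_gt0 kL] := linear_lipschitz (@linear_rV_continuous _ _ _ L).
  exists k => // x; have := kL (pencil s0 x).
  by rewrite /L /= lker0_lfunK.
have [K1 K1_gt0 b1] := bound vsval (@linearP _ _ _ _ vsval).
have [K2 K2_gt0 b2] := bound a (@linearP _ _ _ _ a).
have K2i : 0 < (2 * K2)^-1 by rewrite invr_gt0 mulr_gt0.
exists (2 * K1); near=> s => x.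
have hs : `|s - s0| <= (2 * K2)^-1.
  rewrite distrC; apply: ltW; near: s.
  exact: (nbhsx_ballx s0 _ K2i).
have h1 : `|pencil s0 x| - 2^-1 * `|pencil s0 x| <= `|pencil s x|.
  have -> : pencil s x = pencil s0 x - (s0 - s) *: a x.
    by rewrite !pencilE; apply/rowP => i; rewrite !mxE; ring.
  apply: le_trans (lerB_dist _ _); rewrite lerD2l lerN2 normrZ distrC.
  apply: (@le_trans _ _ ((2 * K2)^-1 * (K2 * `|pencil s0 x|))).
    by apply: ler_pM.
  by rewrite invfM mulrA mulfVK // gt_eqF.
apply: le_trans (b1 x) _; rewrite (mulrC 2) -mulrA ler_pM2l //; lra.
Unshelve. all: by end_near.
Qed.

Lemma gamma_affine x v : gamma x v = lambda x v + tau x.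
Proof. by []. Qed.

Lemma lambda_continuous x : continuous (lambda x).
Proof.
pose L : {linear V -> V} := HB.pack (lambda x)
  (GRing.isLinear.Build _ _ _ _ _ (lambda_linear x)).
exact: (@linear_rV_continuous _ _ _ L).
Qed.

(* Unique lifting for the covering V -> V / Gamma: p_s is injective uniformly
   for s near a given value, so discreteness of Gamma makes the element of
   Gamma relating two lifts locally constant. *)
Lemma lift_unique (X : topologicalType) (F1 F2 : X -> V) (u : X) :
  {for u, continuous F1} -> {for u, continuous F2} ->
  (\forall z \near u, proj (F1 z) = proj (F2 z)) ->
  exists2 x, Gamma M x & \forall z \near u, F1 z = gamma x (F2 z).
Proof.
move=> c1 c2 F12; have /projP[x0 Gx0 E0] := nbhs_singleton F12.
exists x0 => //.
have [e e0 gap] := lattice_gap.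
have [K bK] := pencil_bound (l0 (F2 u)).
pose drop v := v - l v1 v *: v0.
have drop_lin : linear drop.
  by move=> c v w; rewrite /drop !formE; apply/rowP => i; rewrite !mxE; ring.
pose dropL : {linear V -> V} := HB.pack drop
  (GRing.isLinear.Build _ _ _ _ _ drop_lin).
pose E z := drop (F1 z - gamma x0 (F2 z)).
have cE : E z @[z --> u] --> E u.
  have cG : gamma x0 (F2 z) @[z --> u] --> gamma x0 (F2 u).
    apply: cvgD; last exact: cvg_cst.
    exact: (cvg_comp F2 (lambda x0) c2 (@lambda_continuous x0 (F2 u))).
  exact: (cvg_comp (fun z => F1 z - gamma x0 (F2 z)) drop (cvgB c1 cG)
    (@linear_rV_continuous _ _ _ dropL _)).
have Eu : E u = 0 by rewrite /E E0 subrr /drop form0r scale0r subr0.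
have eK : 0 < (`|K| + 1)^-1 * e by rewrite mulr_gt0 // invr_gt0 ltr_wpDl.
have nE : \forall z \near u, `|E u - E z| < (`|K| + 1)^-1 * e.
  by move/cvgrPdist_lt : cE; apply.
have cs : l0 (F2 z) @[z --> u] --> l0 (F2 u).
  exact: (cvg_comp F2 (l v0) c2 (@form_continuous _ _ l v0 (F2 u))).
near=> z.
have /projP[x Gx xE] : proj (F1 z) = proj (F2 z) by near: z.
have xz : drop (F1 z - gamma x0 (F2 z)) = pencil (l0 (F2 z)) (x - x0).
  rewrite xE !gammaE (linearB (pencil _)) /= /drop !formE !l1_pencil l10.
  by apply/rowP => i; rewrite !mxE; ring.
suff : x - x0 = 0 by move/subr0_eq => <-.
apply: gap; first exact: GammaB.
apply: (@le_lt_trans _ _ (K * `|E z|)).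
  rewrite /E xz; move: (x - x0); near: z.
  exact: (cs _ bK).
apply: (@le_lt_trans _ _ ((`|K| + 1) * `|E z|)).
  by rewrite ler_wpM2r // (le_trans (ler_norm K)) // lerDl.
rewrite -ltr_pdivlMl ?ltr_wpDl //.
rewrite -[`|E z|](_ : `|E u - E z| = _); last by rewrite Eu sub0r normrN.
by near: z.
Unshelve. all: by end_near.
Qed.

End Realization.

Lemma form_polarization (R : realType) (T : zmodType) (n n' : nat)
    (b : {symmetric 'rV[R]_n}) (b' : {symmetric 'rV[R]_n'})
    (f : T -> 'rV[R]_n) (f' : T -> 'rV[R]_n') :
  {morph f : u v / u + v} -> {morph f' : u v / u + v} ->
  (forall z, b (f z) (f z) = b' (f' z) (f' z)) ->
  forall x y, b (f x) (f y) = b' (f' x) (f' y).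
Proof.
move=> fD fD' E x y; have := E (x + y).
rewrite fD fD' !formE !E (formC b (f y) (f x)) (formC b' (f' y) (f' x)); lra.
Qed.

Lemma form_pencil (R : realType) (n n' : nat)
    (b : {symmetric 'rV[R]_n}) (b' : {symmetric 'rV[R]_n'}) (al : R) x y u v x' y' u' v' :
  (forall s, b (x + s *: u) (y + s *: v) =
     b' (x' + (s * al) *: u') (y' + (s * al) *: v')) ->
  [/\ b x y = b' x' y', b u v = al ^+ 2 * b' u' v' &
      b x v + b u y = al * (b' x' v' + b' u' y')].
Proof.
move=> E; have := E 0; have := E 1; have := E (-1).
by rewrite !formE; split; lra.
Qed.

Section SecondFundamentalForm.
Variables (R : realType) (M : realization R).
Local Notation V := 'rV[R]_(dimV M).
Local Notation T := (subvs_of (spaceT M)).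
Local Notation l := (ell M).
Local Notation a := (mapa M).
Implicit Types (x y t : T).

Lemma spaceN_null v : v \in spaceN M -> l v v = 0 -> v = 0.
Proof.
move=> vN vv; apply/eqP/negPn/negP => v0.
by have := spaceN_negative vN v0; rewrite vv ltxx.
Qed.

Lemma spaceT_null x : (forall y, l (vsval x) (vsval y) = 0) -> x = 0.
Proof. by move=> h; apply/val_inj/(spaceN_null (spaceT_N x)). Qed.

Lemma map_a'_exists : exists c : 'End(T), forall x y,
  l (vsval (c x)) (vsval y) = l (a x) (vsval y).
Proof.
pose m := dimT M; pose e := vbasis (fullv : {vspace T}).
pose gram v : 'rV[R]_(\dim (fullv : {vspace T})) := \row_j l v (vsval (tnth e j)).
have gram_lin : linear gram.
  by move=> c u v; apply/rowP => j; rewrite !mxE formDl formZl.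
pose G : {linear V -> 'rV[R]_(\dim (fullv : {vspace T}))} := HB.pack gram
  (GRing.isLinear.Build _ _ _ _ _ gram_lin).
pose g := (linfun G \o linfun vsval)%VF : 'Hom(T, _).
have gE x : g x = gram (vsval x) by rewrite comp_lfunE !lfunE.
have gramP u v : gram u = gram v -> forall y, l u (vsval y) = l v (vsval y).
  move=> uv y; have -> : y = \sum_j coord e j y *: tnth e j.
    rewrite {1}(coord_vbasis (memvf y)); apply: eq_bigr => j _.
    by rewrite (tnth_nth 0).
  rewrite linear_sum !form_sumr; apply: eq_bigr => j _.
  rewrite linearZ !formZr; congr (_ * _).
  by have /rowP/(_ j) := uv; rewrite !mxE.
have k0 : lker g == 0%VS.
  rewrite -subv0; apply/subvP => x; rewrite memv_ker memv0 gE => /eqP gx.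
  apply/eqP/spaceT_null => y; rewrite (gramP _ 0) ?form0l //.
  by rewrite gx; apply/rowP => j; rewrite !mxE form0l.
have lg : limg g = fullv.
  apply/eqP; rewrite eqEdim subvf /= limg_dim_eq ?(eqP k0) ?capv0 //.
  by rewrite dimvf /dim /= mul1n.
exists (g^-1 \o (linfun G \o a))%VF => x; apply: gramP.
rewrite -gE [X in g X]comp_lfunE limg_lfunVK; first by rewrite comp_lfunE lfunE.
by rewrite lg memvf.
Qed.

Lemma map_a'P x y : l (vsval (map_a' M x)) (vsval y) = l (a x) (vsval y).
Proof. by move: x y; apply: (xgetPex 0 map_a'_exists). Qed.

Lemma map_a'_eq x t : a x = vsval t -> map_a' M x = t.
Proof.
move=> axt; apply/subr0_eq/spaceT_null => y.
by rewrite linearB /= formDl formNl map_a'P axt subrr.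
Qed.

Lemma map_a''_eq0 x : (map_a'' M x == 0) = (a x == vsval (map_a' M x)).
Proof. by rewrite add_lfunE opp_lfunE comp_lfunE lfunE subr_eq0. Qed.

Lemma dim_spaceR : (\dim (spaceR M) + \dim (lker (map_a'' M)) = dimT M)%N.
Proof.
by rewrite addnC -[lker _]capfv limg_ker_dim dimvf.
Qed.

End SecondFundamentalForm.

Section Similarity.
Variables (R : realType).

Definition similarity (M M' : realization R)
    (phi : 'Hom(subvs_of (spaceT M), subvs_of (spaceT M'))) (al be : R) :=
  forall s x, qform s x = qform (al * s + be) (phi x).

Section Consequences.
Variables (M M' : realization R).
Local Notation T := (subvs_of (spaceT M)).
Local Notation T' := (subvs_of (spaceT M')).
Variables (phi : 'Hom(T, T')) (al be : R).
Hypothesis sim : similarity phi al be.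
Local Notation l := (ell M).
Local Notation l' := (ell M').
Local Notation a := (mapa M).
Local Notation a' := (mapa M').
Implicit Types (x y : T).

Definition shiftT x : 'rV[R]_(dimV M') := vsval (phi x) + be *: a' (phi x).

Lemma similarity_polar s x y :
  l (vsval x + s *: a x) (vsval y + s *: a y) =
  l' (shiftT x + (s * al) *: a' (phi x)) (shiftT y + (s * al) *: a' (phi y)).
Proof.
pose f z := vsval z + s *: a z.
pose f' z := shiftT z + (s * al) *: a' (phi z).
have fD : {morph f : u v / u + v}
  by move=> u v; rewrite /f !linearD /=; apply/rowP => i; rewrite !mxE; ring.
have fD' : {morph f' : u v / u + v}.
  by move=> u v; rewrite /f' /shiftT !linearD /=; apply/rowP => i; rewrite !mxE; ring.
have E z : l (f z) (f z) = l' (f' z) (f' z).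
  have /oppr_inj := sim s z; rewrite -/(f z) => ->.
  suff -> : f' z = vsval (phi z) + (al * s + be) *: a' (phi z) by [].
  by rewrite /f' /shiftT; apply/rowP => i; rewrite !mxE; ring.
exact: (form_polarization fD fD' E).
Qed.

Lemma similarityTT x y : l (vsval x) (vsval y) = l' (shiftT x) (shiftT y).
Proof. by have [] := form_pencil (fun s => similarity_polar s x y). Qed.

Lemma similarityaa x y : l (a x) (a y) = al ^+ 2 * l' (a' (phi x)) (a' (phi y)).
Proof. by have [] := form_pencil (fun s => similarity_polar s x y). Qed.

Lemma similarityaT x y : l (a x) (vsval y) = al * l' (a' (phi x)) (shiftT y).
Proof.
have [_ _] := form_pencil (fun s => similarity_polar s x y).
have -> : l' (shiftT x) (a' (phi y)) = l' (a' (phi x)) (shiftT y).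
  by rewrite /shiftT !formE (@mapa_sym _ M').
rewrite -(@mapa_sym _ M x y); lra.
Qed.

Hypothesis al0 : al != 0.
Hypothesis phi_inj : injective phi.

Lemma similarity_lker : (\dim (lker a) <= \dim (lker a'))%N.
Proof.
have k0 : lker phi == 0%VS by apply/lker0P.
rewrite -(@limg_dim_eq _ _ _ phi (lker a)) ?(eqP k0) ?capv0 //.
apply: dimvS; apply/subvP => _ /memv_imgP[x xa ->]; rewrite memv_ker.
move: xa; rewrite memv_ker => /eqP ax.
apply/eqP/(spaceN_null (mapa_N _)).
have := similarityaa x x; rewrite ax form0l => /esym/eqP.
by rewrite mulf_eq0 expf_eq0 (negbTE al0) /= => /eqP.
Qed.

Lemma similarity_relation x y : a x = vsval y ->
  al *: a' (phi x) = vsval (phi y) + be *: a' (phi y).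
Proof.
move=> axy; apply/subr0_eq; rewrite -/(shiftT y); apply: spaceN_null.
  by rewrite !(memvB, memvD, memvZ) ?mapa_N ?spaceT_N.
have E1 := similarityaa x x; have E2 := similarityaT x y; have E3 := similarityTT y y.
rewrite axy in E1 E2.
have sq u w : l' (u - w) (u - w) = l' u u - 2 * l' u w + l' w w.
  by rewrite !formE (formC l' w u); ring.
rewrite sq (formZl _ al) (formZr _ al) (formZl _ al); lra.
Qed.

(* ker a'' = {x : a x in T}, and if a x = y in T, then a' maps
   al phi x - be phi y to phi y. *)
Lemma similarity_lker_a'' : (\dim (lker (map_a'' M)) <= \dim (lker (map_a'' M')))%N.
Proof.
pose K := lker (map_a'' M).
pose theta := (al *: phi - be *: (phi \o map_a' M))%VF.
have thetaE x : theta x = al *: phi x - be *: phi (map_a' M x).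
  by rewrite add_lfunE opp_lfunE !scale_lfunE comp_lfunE.
have athetaE x : x \in K -> a' (theta x) = vsval (phi (map_a' M x)).
  rewrite memv_ker map_a''_eq0 => /eqP /similarity_relation E.
  have aE u w : a' (al *: u - be *: w) = al *: a' u - be *: a' w.
    by rewrite linearB !linearZ.
  by rewrite thetaE aE E addrK.
rewrite -(@limg_dim_eq _ _ _ theta K).
  apply: dimvS; apply/subvP => _ /memv_imgP[x xK ->].
  by rewrite memv_ker map_a''_eq0 athetaE // (map_a'_eq (athetaE _ xK)).
apply/eqP; rewrite -subv0; apply/subvP => x; rewrite memv_cap memv0 => /andP[xK].
rewrite memv_ker => /eqP tx; have := athetaE _ xK.
rewrite tx linear0 => /esym h; have px : phi (map_a' M x) = 0 by apply: val_inj.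
move: tx; rewrite thetaE px scaler0 subr0 => /eqP; rewrite scaler_eq0 (negbTE al0) /=.
by move=> /eqP h'; apply/eqP/phi_inj; rewrite h' linear0.
Qed.

End Consequences.
End Similarity.

Section IntegralEquivalence.
Variable R : realType.

(* Z-equivalence of matrix polynomials whose sizes are not yet known to agree;
   X Y = 1 and Y X = 1 force m = m'. *)
Definition integrally_equivalent (m m' : nat) (Q : R -> 'M[R]_m) (Q' : R -> 'M[R]_m')
    (al be : R) :=
  exists (X : 'M[int]_(m', m)) (Y : 'M[int]_(m, m')),
    [/\ X *m Y = 1%:M, Y *m X = 1%:M &
        forall s, Q s = (map_mx intr X)^T *m Q' (al * s + be) *m map_mx intr X].

Lemma integrally_equivalentP (m m' : nat) (Q : R -> 'M[R]_m) (Q' : R -> 'M[R]_m') al be :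
  integrally_equivalent Q Q' al be <->
  exists (eqm : m' = m) (X : 'M[int]_m), X \in unitmx /\
    forall s, Q s = (map_mx intr X)^T *m castmx (eqm, eqm) (Q' (al * s + be))
                    *m map_mx intr X.
Proof.
split=> [[X [Y [XY YX h]]]|[eqm]].
  have mm' : m' = m by apply/eqP; rewrite eqn_leq (mulmx1_min XY) (mulmx1_min YX).
  subst m'; exists erefl, X; split; first by have [] := mulmx1_unit XY.
  by move=> s; rewrite castmx_id.
subst m' => -[X [uX h]]; exists X, (invmx X).
by rewrite mulmxV // mulVmx //; split=> // s; rewrite h castmx_id.
Qed.

Lemma symmetric_mx_eq m (P P' : 'M[R]_m) : P^T = P -> P'^T = P' ->
  (forall z : 'cV[int]_m, ((map_mx intr z)^T *m P *m map_mx intr z) 0 0 =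
                          ((map_mx intr z)^T *m P' *m map_mx intr z) 0 0) ->
  P = P'.
Proof.
move=> sP sP' E.
pose b (N : 'M[R]_m) (u v : 'cV[R]_m) := (u^T *m N *m v) 0 0.
have bD N u v w : b N (u + v) w = b N u w + b N v w.
  by rewrite /b linearD !mulmxDl !mxE.
have bDr N u v w : b N w (u + v) = b N w u + b N w v.
  by rewrite /b mulmxDr !mxE.
have bC N u v : N^T = N -> b N u v = b N v u.
  move=> sN; rewrite /b -[LHS](_ : ((u^T *m N *m v)^T) 0 0 = _); last by rewrite mxE.
  by rewrite !trmx_mul trmxK sN mulmxA.
have be N i j : b N (delta_mx i 0) (delta_mx j 0) = N i j.
  by rewrite /b trmx_delta -rowE -colE !mxE.
have Ez (z : 'cV[int]_m) :
    b P (map_mx intr z) (map_mx intr z) = b P' (map_mx intr z) (map_mx intr z).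
  exact: E.
apply/matrixP => i j.
have := Ez (delta_mx i 0 + delta_mx j 0); have := Ez (delta_mx i 0); have := Ez (delta_mx j 0).
rewrite map_mxD !map_delta_mx !bD !bDr (bC P (delta_mx j 0) (delta_mx i 0) sP)
  (bC P' (delta_mx j 0) (delta_mx i 0) sP') !be.
lra.
Qed.

End IntegralEquivalence.

Section Frame.
Variables (R : realType) (M : realization R).
Local Notation T := (subvs_of (spaceT M)).
Local Notation m := (dimT M).

Definition lattice_frame (Q : R -> 'M[R]_m) (iota : 'Hom('cV[R]_m, T))
    (kappa : 'Hom(T, 'cV[R]_m)) :=
  [/\ cancel iota kappa, cancel kappa iota,
      forall x, Gamma M x <-> exists z : 'cV[int]_m, x = iota (map_mx intr z),
      forall s, (Q s)^T = Q s &
      forall s z, qform s (iota z) = (z^T *m Q s *m z) 0 0].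

Lemma characteristic_frame Q : characteristic_polynomial M Q ->
  exists iota kappa, lattice_frame Q iota kappa.
Proof.
move=> [iota [A [B [C [[g gK Kg] iG [sA sB sC] qE QE]]]]].
have k0 : lker iota == 0%VS by apply/lker0P; apply: can_inj gK.
have lf : limg iota = fullv.
  apply/eqP; rewrite eqEsubv subvf /=; apply/subvP => x _.
  by rewrite -(Kg x) memv_img ?memvf.
exists iota, (iota^-1)%VF; split.
- exact: lker0_lfunK.
- by move=> x; rewrite limg_lfunVK // lf memvf.
- move=> x; rewrite -iG; split=> [[_ [z _ <-] <-]|[z ->]]; first by exists z.
  by exists (map_mx intr z) => //; exists z.
- by move=> s; rewrite QE !linearD !linearZ /= sA sB sC.
- move=> s z; rewrite qE -QE -mulmxA !mxE; apply: eq_bigr => i _.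
  by rewrite mulrC !mxE.
Qed.

End Frame.

Section CharacteristicSimilarity.
Variables (R : realType) (M M' : realization R).
Local Notation T := (subvs_of (spaceT M)).
Local Notation T' := (subvs_of (spaceT M')).
Variables (Q : R -> 'M[R]_(dimT M)) (Q' : R -> 'M[R]_(dimT M')).
Hypotheses (hQ : characteristic_polynomial M Q) (hQ' : characteristic_polynomial M' Q').

Lemma equivalent_similarity al be : integrally_equivalent Q Q' al be ->
  exists (phi : 'Hom(T, T')) (psi : 'Hom(T', T)),
    [/\ cancel phi psi, cancel psi phi, forall x, Gamma M x -> Gamma M' (phi x),
        forall y, Gamma M' y -> Gamma M (psi y) & similarity phi al be].
Proof.
move=> [X [Y [XY YX QE]]].
have [iota [kappa [ik ki G _ qE]]] := characteristic_frame hQ.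
have [iota' [kappa' [ik' ki' G' _ qE']]] := characteristic_frame hQ'.
have XYR : map_mx intr X *m map_mx intr Y = 1%:M :> 'M[R]__ by rewrite -map_mxM XY map_mx1.
have YXR : map_mx intr Y *m map_mx intr X = 1%:M :> 'M[R]__ by rewrite -map_mxM YX map_mx1.
pose phi := (iota' \o linfun (mulmx (map_mx intr X)) \o kappa)%VF : 'Hom(T, T').
pose psi := (iota \o linfun (mulmx (map_mx intr Y)) \o kappa')%VF : 'Hom(T', T).
have phiE x : phi x = iota' (map_mx intr X *m kappa x) by rewrite !comp_lfunE lfunE.
have psiE x : psi x = iota (map_mx intr Y *m kappa' x) by rewrite !comp_lfunE lfunE.
exists phi, psi; split.
- by move=> x; rewrite psiE phiE ik' mulmxA YXR mul1mx ki.
- by move=> x; rewrite phiE psiE ik mulmxA XYR mul1mx ki'.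
- move=> x /G[z ->]; apply/G'; exists (X *m z).
  by rewrite phiE ik map_mxM.
- move=> x /G'[z ->]; apply/G; exists (Y *m z).
  by rewrite psiE ik' map_mxM.
move=> s x; rewrite phiE -{1}(ki x) qE qE' QE trmx_mul.
by rewrite !mulmxA.
Qed.

End CharacteristicSimilarity.

Lemma similarity_inv (R : realType) (M M' : realization R)
    (phi : 'Hom(subvs_of (spaceT M), subvs_of (spaceT M')))
    (psi : 'Hom(subvs_of (spaceT M'), subvs_of (spaceT M))) al be :
  cancel psi phi -> al != 0 -> similarity phi al be ->
  similarity psi al^-1 (- (al^-1 * be)).
Proof.
move=> K al0 sim s y; rewrite sim K; congr (qform _ _); by field.
Qed.

Lemma equivalent_signature (R : realType) (M M' : realization R) Q Q' (al be : R) :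
  characteristic_polynomial M Q -> characteristic_polynomial M' Q' ->
  dimV M = dimV M' -> al != 0 -> integrally_equivalent Q Q' al be ->
  signature M = signature M'.
Proof.
move=> hQ hQ' nn' al0 eQ.
have mm' : dimT M = dimT M' by have /integrally_equivalentP[e _] := eQ.
have [phi [psi [K K' _ _ sim]]] := equivalent_similarity hQ hQ' eQ.
have sim' := similarity_inv K' al0 sim.
have al0' : al^-1 != 0 by rewrite invr_eq0.
have [i i'] := (can_inj K, can_inj K').
have k : \dim (lker (mapa M)) = \dim (lker (mapa M')).
  by apply/eqP; rewrite eqn_leq (similarity_lker sim) // (similarity_lker sim').
have r : \dim (lker (map_a'' M)) = \dim (lker (map_a'' M')).
  by apply/eqP; rewrite eqn_leq (similarity_lker_a'' sim) // (similarity_lker_a'' sim').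
have r' : \dim (spaceR M) = \dim (spaceR M').
  by apply/eqP; rewrite -(eqn_add2r (\dim (lker (map_a'' M)))) {2}r !dim_spaceR mm'.
by do !congr pair.
Qed.

Section AffineDifferential.
Variables (R : realType) (V : normedModType R) (n n' : nat).
Variables (G : {linear 'rV[R]_n -> 'rV[R]_n'}) (c : 'rV[R]_n').

Lemma affine_differentiable v : differentiable (fun z => G z + c) v.
Proof.
apply: differentiableD; first exact: linear_rV_differentiable.
exact: differentiable_cst.
Qed.

Lemma is_derive_affine_comp (F : V -> 'rV[R]_n) p v df : is_derive p v F df ->
  is_derive p v (fun z => G (F z) + c) (G df).
Proof.
move=> dF; rewrite -[G df]addr0; apply: is_deriveD.
by apply: is_derive_linear => //; exact: linear_rV_continuous.
Qed.

End AffineDifferential.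

Lemma diff_affine (R : realType) n n' (G : {linear 'rV[R]_n -> 'rV[R]_n'}) c v x :
  'd (fun z => G z + c) v x = G x.
Proof.
have h := is_derive_affine_comp G c (is_derive_id v x).
rewrite -(deriveE _ (affine_differentiable G c v)); exact: (@derive_val _ _ _ _ _ _ _ h).
Qed.

Section Descent.
Variables (R : realType) (M M' : realization R).

Lemma descend (F : 'rV[R]_(dimV M) -> 'rV[R]_(dimV M')) :
  (forall x v, Gamma M x -> exists2 y, Gamma M' y & F (gamma x v) = gamma y (F v)) ->
  exists f : manifold M -> manifold M', forall v, f (proj v) = proj (F v).
Proof.
move=> hF; exists (fun A => proj (F (sval (cid (proj_surj A))))) => v.
case: cid => w /= /esym/projP[x Gx ->]; apply/projP.
exact: hF.
Qed.

Variables (L : 'Hom('rV[R]_(dimV M), 'rV[R]_(dimV M'))) (c : 'rV[R]_(dimV M')).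
Variable f : manifold M -> manifold M'.
Hypothesis fE : forall v, f (proj v) = proj (L v + c).

Lemma affine_local_lift : local_lift f setT (fun v => L v + c).
Proof.
split=> //; first exact: openT.
by apply: (smooth_affine_comp L c openT); exact: smooth_id.
Qed.

Lemma affine_smooth_map : smooth_map f.
Proof. by move=> v; exists setT, (fun v => L v + c); split=> //; exact: affine_local_lift. Qed.

Lemma local_lift_differentiable U F v : local_lift f U F -> U v -> differentiable F v.
Proof. by case=> _ /(_ 1) [+ _] _; apply. Qed.

Lemma affine_preserves_metric : form_isometry (ell M) (ell M') L -> preserves_metric f.
Proof.
move=> iL U F lF v Uv x y; have dF := local_lift_differentiable lF Uv.
have [oU _ Ff] := lF.
pose A z := L z + c.
have dA : differentiable A v by exact: (affine_differentiable L).
have [g Gg gE] : exists2 g, Gamma M' g & \forall z \near v, F z = gamma g (A z).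
  apply: lift_unique; [exact: differentiable_continuous|exact: differentiable_continuous|].
  by apply: filterS (open_nbhs_nbhs (conj oU Uv)) => z Uz; rewrite Ff // fE.
pose G : {linear 'rV[R]_(dimV M') -> 'rV[R]_(dimV M')} := HB.pack (lambda g)
  (GRing.isLinear.Build _ _ _ _ _ (lambda_linear g)).
pose GL : {linear 'rV[R]_(dimV M) -> 'rV[R]_(dimV M')} := G \o L.
have E z : 'd F v z = lambda g (L z).
  rewrite (@near_eq_diff _ _ _ F (fun z => GL z + (lambda g c + tau g))) //.
    by rewrite diff_affine.
  apply: filterS gE => u ->; rewrite gamma_affine.
  have -> : lambda g (A u) = GL u + lambda g c by exact: (linearD G).
  exact/esym/addrA.
by rewrite !E lambda_isometry iL.
Qed.

Lemma affine_causal : (forall v, cone M v -> cone M' (L v)) -> causal f.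
Proof.
move=> hL I g oI iI hg t It; have [J [g' [oJ Jt sg' gE cg']]] := hg t It.
exists J, (fun s => L (g' s) + c); split=> //.
- exact: (smooth_affine_comp L c oJ).
- by move=> s Js /=; rewrite -gE // fE.
- move=> s Js; rewrite derive1E.
  have [/(_ s Js) dg _] := sg' 1%N.
  have h : is_derive s 1 g' (derive1 g' s).
    by rewrite derive1E; apply: derivableP; exact: diff_derivable.
  have [_ ->] := is_derive_affine_comp L c h.
  exact/hL/cg'.
Qed.

End Descent.

Section SimilarityIsometry.
Variables (R : realType) (M M' : realization R).
Local Notation V := 'rV[R]_(dimV M).
Local Notation V' := 'rV[R]_(dimV M').
Local Notation T := (subvs_of (spaceT M)).
Local Notation T' := (subvs_of (spaceT M')).
Local Notation l := (ell M).
Local Notation l' := (ell M').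
Local Notation a := (mapa M).
Local Notation a' := (mapa M').
Variables (phi : 'Hom(T, T')) (al be : R).
Hypotheses (sim : similarity phi al be) (al_gt0 : 0 < al) (nn' : dimV M = dimV M').

Let al0 : al != 0. Proof. by rewrite gt_eqF. Qed.

Let src (c d : R) (x y : T) := c *: v0 M + d *: v1 M + (vsval x + a y).
Let dst (c d : R) (x y : T) := (c / al) *: v0 M' + (d * al) *: v1 M' +
  (shiftT phi be x + al *: a' (phi y)).

Lemma src_dst_gram c d x y c2 d2 x2 y2 :
  l' (dst c d x y) (dst c2 d2 x2 y2) = l (src c d x y) (src c2 d2 x2 y2).
Proof.
have orth (N : realization R) u w p q p2 q2 : u \in spaceN N -> w \in spaceN N ->
    ell N (p *: v0 N + q *: v1 N + u) (p2 *: v0 N + q2 *: v1 N + w) =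
    p * q2 + q * p2 + ell N u w.
  move=> /spaceNP[u0 u1] /spaceNP[w0 w1].
  rewrite !formE (formC _ u) (formC _ u (v1 N)) u0 u1 w0 w1 l00 l11 l01 l10; ring.
have aN x0 : shiftT phi be x0 \in spaceN M'.
  by rewrite memvD ?memvZ ?mapa_N ?spaceT_N.
rewrite /src /dst !orth ?memvD ?memvZ ?mapa_N ?spaceT_N //.
have aT := similarityaT sim y x2; have Ta := similarityaT sim y2 x.
have TT := similarityTT sim x x2; have aa := similarityaa sim y y2.
congr (_ + _); first by field.
rewrite (formDl l) !(formDr l) (formC l (vsval x) (a y2)) aT Ta TT aa.
move: (shiftT phi be x) (shiftT phi be x2) => X X2.
rewrite (formDl l') !(formDr l') (formC l' X (_ *: _)) !formZl !formZr; ring.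
Qed.

Lemma similarity_isometry : exists L : 'Hom(V, V'), [/\ form_isometry l l' L,
  L (v0 M) = al^-1 *: v0 M', L (v1 M) = al *: v1 M',
  forall x, L (vsval x) = shiftT phi be x & forall x, L (a x) = al *: a' (phi x)].
Proof.
pose pr c d x y := (src c d x y, dst c d x y).
pose e := vbasis (fullv : {vspace T}).
pose s := pr 1 0 0 0 :: [seq pr 0 0 x 0 | x <- e] ++ [seq pr 0 0 0 y | y <- e].
have sE p : p \in pr 1 1 0 0 :: s -> exists c d x y, p = pr c d x y.
  rewrite !inE mem_cat => /or4P[/eqP->|/eqP->|/mapP[x _ ->]|/mapP[x _ ->]];
  by do 4!eexists; reflexivity.
have [|p q /sE[c [d [x [y ->]]]] /sE[c2 [d2 [x2 [y2 ->]]]]|L iL LE] :=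
  @lorentz_extension _ _ _ l l' (dimV_ge2 M') nn' (ell_lorentzian M)
    (ell_lorentzian M') (pr 1 1 0 0) s.
- by rewrite /= /src !linear0 !addr0 !scale1r !formE !lE add0r addr0 addr_gt0.
- exact: src_dst_gram.
have simp := (linear0, scale0r, scaler0, add0r, addr0, scale1r, mul0r, mul1r).
have shift0 : shiftT phi be 0 = 0 by rewrite /shiftT !linear0 addr0.
have L0 : L (v0 M) = al^-1 *: v0 M'.
  have := LE (pr 1 0 0 0); rewrite inE mem_head orbT => /(_ isT).
  by rewrite /= /src /dst shift0 !simp.
have ei (i : 'I_(\dim (fullv : {vspace T}))) : e`_i \in e.
  by apply: mem_nth; rewrite size_tuple.
have memT (i : 'I_(\dim (fullv : {vspace T}))) : pr 0 0 e`_i 0 \in pr 1 1 0 0 :: s.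
  by rewrite in_cons in_cons mem_cat (map_f (fun x => pr 0 0 x 0) (ei i)) !orbT.
have mema (i : 'I_(\dim (fullv : {vspace T}))) : pr 0 0 0 e`_i \in pr 1 1 0 0 :: s.
  by rewrite in_cons in_cons mem_cat (map_f (fun y => pr 0 0 0 y) (ei i)) !orbT.
have LT x : L (vsval x) = shiftT phi be x.
  rewrite (coord_vbasis (memvf x)) /shiftT !linear_sum /= -big_split /=.
  apply: eq_bigr => i _; rewrite !linearZ /=.
  have := LE _ (memT i); rewrite /= /src /dst !simp => ->.
  by rewrite /shiftT !linearZ /= scalerDr !scalerA (mulrC be).
have La y : L (a y) = al *: a' (phi y).
  rewrite (coord_vbasis (memvf y)) !linear_sum /=.
  apply: eq_bigr => i _; rewrite !linearZ /=.
  have := LE _ (mema i); rewrite /= /src /dst shift0 !simp => ->.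
  by rewrite !scalerA mulrC.
exists L; split=> //.
have := LE (pr 1 1 0 0); rewrite mem_head => /(_ isT).
by rewrite /= /src /dst shift0 !simp linearD /= L0 => /addrI.
Qed.

Lemma similarity_equivariant (L : 'Hom(V, V')) : form_isometry l l' L ->
  L (v0 M) = al^-1 *: v0 M' ->
  (forall x, L (vsval x) = shiftT phi be x) -> (forall x, L (a x) = al *: a' (phi x)) ->
  forall x v, L (gamma x v) + be *: v1 M' = gamma (phi x) (L v + be *: v1 M').
Proof.
move=> iL L0 LT La x v.
have l0L : l0 (L v + be *: v1 M') = al * l0 v + be.
  rewrite /l0 formDr formZr l01 mulr1; congr (_ + _).
  by rewrite -iL L0 formZl mulVKf.
have aE : a' (phi x) = al^-1 *: L (a x) by rewrite La scalerA mulVf ?scale1r.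
have TE : vsval (phi x) = L (vsval x) - be *: a' (phi x) by rewrite LT addrK.
have sh : v0_shift (phi x) (L v + be *: v1 M') = al^-1 * v0_shift x v.
  rewrite /v0_shift l0L formDr formZr (formC _ _ (v1 M')) l1a mulr0 addr0.
  rewrite TE aE !formDr formNr !formZr !formZl !iL; field.
  exact: al0.
rewrite !gammaE !pencilE l0L sh TE aE !linearD linearN !linearZ /= L0.
by apply/rowP => i; rewrite !mxE; field.
Qed.

Lemma similarity_causally_isometric (psi : 'Hom(T', T)) : cancel psi phi ->
  (forall x, Gamma M x -> Gamma M' (phi x)) ->
  (forall y, Gamma M' y -> Gamma M (psi y)) ->
  causally_isometric M M'.
Proof.
move=> K Gphi Gpsi.
have [L [iL L0 L1 LT La]] := similarity_isometry.
have bnd := lorentz_nondegenerate (dimV_ge2 M) (ell_lorentzian M).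
have equi := similarity_equivariant iL L0 LT La.
have k0 : lker L == 0%VS by apply/lker0P; exact: (@form_isometry_inj _ _ _ _ _ bnd L iL).
have lf : limg L = fullv.
  apply/eqP; rewrite eqEdim subvf /= limg_dim_eq ?(eqP k0) ?capv0 //.
  by rewrite !dimvf /dim /= !mul1n nn'.
have LK : cancel L (L^-1)%VF by exact: lker0_lfunK.
have KL : cancel (L^-1)%VF L by move=> w; rewrite limg_lfunVK // lf memvf.
pose c := be *: v1 M'.
pose F v := L v + c; pose F' w := (L^-1)%VF w - (L^-1)%VF c.
have FK v : F' (F v) = v by rewrite /F' /F linearD /= addrK LK.
have KF w : F (F' w) = w by rewrite /F' /F linearB /= !KL subrK.
have [f fE] := @descend _ _ _ F (fun x v Gx => ex_intro2 _ _ (phi x) (Gphi x Gx) (equi x v)).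
have equi' y w : Gamma M' y -> exists2 x, Gamma M x & F' (gamma y w) = gamma x (F' w).
  move=> Gy; exists (psi y); first exact: Gpsi.
  by apply: (can_inj FK); rewrite KF [RHS]equi -/c -/(F _) KF K.
have [g gE] := descend equi'.
exists f; split; last first.
  apply: (affine_causal fE) => v /coneE[vv h0 h1]; apply/coneE; split.
  - by rewrite iL.
  - suff -> : l' (v0 M') (L v) = al * l (v0 M) v by rewrite mulr_ge0 // ltW.
    by rewrite -iL L0 formZl mulVKf.
  - suff -> : l' (v1 M') (L v) = al^-1 * l (v1 M) v by rewrite mulr_ge0 // invr_ge0 ltW.
    by rewrite -iL L1 formZl mulKf.
split; first exact: affine_preserves_metric fE iL.
split; first exact: affine_smooth_map fE.
exists g; first exact: (affine_smooth_map (c := - (L^-1)%VF c) gE).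
split=> A; have [v ->] := proj_surj A.
  by rewrite fE gE FK.
by rewrite gE fE KF.
Qed.

End SimilarityIsometry.

Lemma linear_inj_dim (R : realType) (n n' : nat) (L : {linear 'rV[R]_n -> 'rV[R]_n'}) :
  injective L -> (n <= n')%N.
Proof.
move=> iL; have k0 : lker (linfun L) == 0%VS.
  by apply/lker0P => x y; rewrite !lfunE => /iL.
have := dimvS (subvf (limg (linfun L))).
by rewrite limg_dim_eq ?(eqP k0) ?capv0 // !dimvf /dim /= !mul1n.
Qed.

Lemma affine_near_eq (R : realType) (n n' : nat)
    (L1 L2 : {linear 'rV[R]_n -> 'rV[R]_n'}) c1 c2 (q : 'rV[R]_n) :
  (\forall u \near q, L1 u + c1 = L2 u + c2) -> forall u, L1 u + c1 = L2 u + c2.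
Proof.
move=> E; have LE u : L1 u = L2 u.
  rewrite -(diff_affine L1 c1 q) -(diff_affine L2 c2 q).
  apply: near_eq_diff E _; exact: (affine_differentiable L1 c1 q).
have := nbhs_singleton E; rewrite LE => /addrI cE u.
by rewrite LE cE.
Qed.

Section AffineGamma.
Variables (R : realType) (M : realization R).

Lemma gamma_comp_affine n (L : {linear 'rV[R]_n -> 'rV[R]_(dimV M)}) c x :
  exists (L' : {linear 'rV[R]_n -> 'rV[R]_(dimV M)}) c',
    forall u, gamma x (L u + c) = L' u + c'.
Proof.
pose G : {linear 'rV[R]_(dimV M) -> 'rV[R]_(dimV M)} := HB.pack (lambda x)
  (GRing.isLinear.Build _ _ _ _ _ (lambda_linear x)).
pose GL : {linear 'rV[R]_n -> 'rV[R]_(dimV M)} := G \o L.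
exists GL, (lambda x c + tau x) => u; rewrite gamma_affine.
have -> : lambda x (L u + c) = GL u + lambda x c by exact: (linearD G).
exact/esym/addrA.
Qed.

Lemma affine_comp_gamma n (L : {linear 'rV[R]_(dimV M) -> 'rV[R]_n}) c x :
  exists (L' : {linear 'rV[R]_(dimV M) -> 'rV[R]_n}) c',
    forall u, L (gamma x u) + c = L' u + c'.
Proof.
pose G : {linear 'rV[R]_(dimV M) -> 'rV[R]_(dimV M)} := HB.pack (lambda x)
  (GRing.isLinear.Build _ _ _ _ _ (lambda_linear x)).
pose LG : {linear 'rV[R]_(dimV M) -> 'rV[R]_n} := L \o G.
exists LG, (L (tau x) + c) => u; rewrite gamma_affine (linearD L).
exact/esym/addrA.
Qed.

Lemma qform_gamma x v :
  qform (l0 v) x = - ell M (gamma x v - v) (gamma x v - v).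
Proof.
rewrite qformE; congr (- _).
have -> : gamma x v - v = pencil M (l0 v) x - v0_shift x v *: v0 M.
  by rewrite gammaE; apply/rowP => i; rewrite !mxE; ring.
by rewrite !formE (formC _ _ (v0 M)) l0_pencil l00; ring.
Qed.

End AffineGamma.

Section AffineLift.
Variables (R : realType) (M M' : realization R).
Variables (f : manifold M -> manifold M').
Variables (L : {linear 'rV[R]_(dimV M) -> 'rV[R]_(dimV M')}) (c : 'rV[R]_(dimV M')).
Hypothesis fE : forall v, f (proj v) = proj (L v + c).

Lemma affine_equivariant x : Gamma M x ->
  exists2 y, Gamma M' y & forall v, L (gamma x v) + c = gamma y (L v + c).
Proof.
move=> Gx; have [L1 [c1 E1]] := affine_comp_gamma L c x.
have H z : proj (L1 z + c1) = proj (L z + c).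
  by rewrite -E1 -!fE; congr f; apply/projP; exists x.
have [y Gy E] : exists2 y, Gamma M' y &
    \forall z \near (0 : 'rV[R]_(dimV M)), L1 z + c1 = gamma y (L z + c).
  apply: lift_unique; [exact/differentiable_continuous/affine_differentiable|
    exact/differentiable_continuous/affine_differentiable|].
  exact: (@filterE _ (nbhs (0 : 'rV[R]_(dimV M))) _ _ H).
exists y => // v; have [L2 [c2 E2]] := gamma_comp_affine L c y.
rewrite E1 E2; apply: (affine_near_eq (q := 0)).
by apply: filterS E => z ->.
Qed.

End AffineLift.

Section LocalToGlobal.
Variables (R : realType) (M M' : realization R).
Variables (f : manifold M -> manifold M') (g : manifold M' -> manifold M).
Hypotheses (pf : preserves_metric f) (sf : smooth_map f) (sg : smooth_map g)
  (gf : cancel g f).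
Local Notation V := 'rV[R]_(dimV M).
Local Notation V' := 'rV[R]_(dimV M').

Let bnd : forall v : V, (forall w, ell M v w = 0) -> v = 0.
Proof. by move=> v; apply: (lorentz_nondegenerate (dimV_ge2 M) (ell_lorentzian M)). Qed.
Let bnd' : forall v : V', (forall w, ell M' v w = 0) -> v = 0.
Proof. by move=> v; apply: (lorentz_nondegenerate (dimV_ge2 M') (ell_lorentzian M')). Qed.

Lemma isometry_dim : dimV M = dimV M'.
Proof.
apply/eqP; rewrite eqn_leq; apply/andP; split.
  have [U [F [U0 lF]]] := sf 0.
  by apply: (linear_inj_dim (form_isometry_inj bnd (pf lF U0))).
have [U' [G [U'0 lG]]] := sg 0.
have [U [F [UG lF]]] := sf (G 0).
have dG := local_lift_differentiable lG U'0.
have dF := local_lift_differentiable lF UG.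
have [oU' _ GE] := lG; have [oU _ FE] := lF.
have [y Gy E] : exists2 y, Gamma M' y & \forall z \near (0 : V'), F (G z) = gamma y z.
  apply: lift_unique.
  - exact: (continuous_comp (differentiable_continuous dG) (differentiable_continuous dF)).
  - by move=> A.
  - have nU' : \forall z \near (0 : V'), U' z by exact: open_nbhs_nbhs (conj oU' U'0).
    have nU : \forall z \near (0 : V'), U (G z).
      by apply: (differentiable_continuous dG); exact: open_nbhs_nbhs (conj oU UG).
    by apply: filterS2 nU' nU => z U'z Uz; rewrite FE // GE // gf.
pose Ly : {linear V' -> V'} := HB.pack (lambda y)
  (GRing.isLinear.Build _ _ _ _ _ (lambda_linear y)).
have dFG x : 'd F (G 0) ('d G 0 x) = lambda y x.
  have dc : 'd (F \o G) 0 x = lambda y x.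
    rewrite (@near_eq_diff _ _ _ (F \o G) (fun z => Ly z + tau y)) //.
      exact: (diff_affine Ly (tau y)).
    exact: differentiable_comp.
  by rewrite -dc (diff_comp dG dF).
apply: (@linear_inj_dim _ _ _ ('d G 0)) => u w Guw.
have iy : form_isometry (ell M') (ell M') Ly by move=> p q; exact: lambda_isometry.
by apply: (form_isometry_inj bnd' iy); rewrite /Ly /= -!dFG Guw.
Qed.

Lemma local_lift_affine (v : V) : exists (L : {linear V -> V'}) c,
  form_isometry (ell M) (ell M') L /\ \forall z \near v, f (proj z) = proj (L z + c).
Proof.
have [U [F [Uv lF]]] := sf v; have [oU sF FE] := lF.
have nn' : (dimV M' <= dimV M)%N by rewrite isometry_dim.
exists ('d F v), (F v - 'd F v v); split; first exact: pf lF v Uv.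
have := local_isometry_affine nn' bnd bnd' oU (sF 2%N) (pf lF) Uv.
have nU : \forall z \near v, U z by exact: open_nbhs_nbhs (conj oU Uv).
apply: filterS2 nU => z Uz E; rewrite -FE // E linearB.
by congr proj; exact: addrCA.
Qed.

(* The set of points near which f is covered by a fixed affine map is open, and
   closed because two affine local lifts differ by an element of Gamma. *)
Lemma global_affine_lift : exists (L : {linear V -> V'}) c,
  form_isometry (ell M) (ell M') L /\ forall v, f (proj v) = proj (L v + c).
Proof.
have [L [c [iL E0]]] := local_lift_affine 0; exists L, c; split=> //.
pose P := [set z | f (proj z) = proj (L z + c)].
have cP : closed P°.
  move=> z zP; have [L1 [c1 [_ E1]]] := local_lift_affine z.
  have /nbhs_ballP[r /= r0 hr] := E1.
  have [q [qP qr]] := zP _ (nbhsx_ballx z r r0).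
  have nr : \forall u \near q, ball z r u.
    by apply: open_nbhs_nbhs; split=> //; exact: ball_open.
  have [y Gy E] : exists2 y, Gamma M' y &
      \forall u \near q, L u + c = gamma y (L1 u + c1).
    apply: lift_unique; [exact/differentiable_continuous/affine_differentiable|
      exact/differentiable_continuous/affine_differentiable|].
    by apply: filterS2 qP nr => u Pu /hr <-.
  have [L2 [c2 E2]] := gamma_comp_affine L1 c1 y.
  have E' : forall u, L u + c = L2 u + c2.
    by apply: (affine_near_eq (q := q)); apply: filterS E => u ->.
  apply/nbhs_ballP; exists r => //= u /hr; rewrite /P /= => ->.
  by apply/esym/projP; exists y => //; rewrite E' -E2.
move=> v; pose line (t : R) : V := t *: v.
have cline : continuous line by move=> t; exact: scalel_continuous.
pose S := line @^-1` P°.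
have ST : S = setT.
  have /connected_intervalP : is_interval (@setT R) by [].
  apply.
  - by exists 0; rewrite /S /line /preimage /= scale0r.
  - exists S; last by rewrite setTI.
    by apply: open_comp; [move=> t _; exact: cline|exact: open_interior].
  - exists S; last by rewrite setTI.
    by apply: preimage_closed => // t _; exact: cline.
have : S 1 by rewrite ST.
by rewrite /S /line /preimage /= scale1r => /interior_subset.
Qed.

End LocalToGlobal.

Lemma additive_int_matrix m m' (h : 'cV[int]_m -> 'cV[int]_m') :
  {morph h : x y / x + y} -> exists X : 'M[int]_(m', m), forall z, h z = X *m z.
Proof.
move=> hD.
have h0 : h 0 = 0 by apply: (addrI (h 0)); rewrite -hD !addr0.
pose H : {additive 'cV[int]_m -> 'cV[int]_m'} := HB.pack h
  (GRing.isNmodMorphism.Build _ _ h (conj h0 hD)).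
exists (\matrix_(i, j) h (delta_mx j 0) i 0) => z.
rewrite -[h]/(H : _ -> _) {1}(matrix_sum_delta z) raddf_sum.
apply/colP => i; rewrite summxE !mxE; apply: eq_bigr => j _.
have kz p (k : int) (N : 'cV[int]_p) : k *: N = N *~ k by rewrite -scaler_int intz.
by rewrite big_ord1 kz raddfMz -kz !mxE mulrC.
Qed.

Lemma map_intr_mx_inj (R : realType) m n :
  injective (map_mx (intr : int -> R) : 'M[int]_(m, n) -> 'M[R]_(m, n)).
Proof.
by move=> A B /matrixP E; apply/matrixP => i j; have := E i j; rewrite !mxE => /intr_inj.
Qed.

Section LatticeMatrix.
Variables (R : realType) (M M' : realization R).
Local Notation V := 'rV[R]_(dimV M).
Local Notation V' := 'rV[R]_(dimV M').
Variables (Q : R -> 'M[R]_(dimT M)) (Q' : R -> 'M[R]_(dimT M')).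
Variables (iota : 'Hom('cV[R]_(dimT M), subvs_of (spaceT M))).
Variables (kappa : 'Hom(subvs_of (spaceT M), 'cV[R]_(dimT M))).
Variables (iota' : 'Hom('cV[R]_(dimT M'), subvs_of (spaceT M'))).
Variables (kappa' : 'Hom(subvs_of (spaceT M'), 'cV[R]_(dimT M'))).
Hypotheses (fr : lattice_frame Q iota kappa) (fr' : lattice_frame Q' iota' kappa').

Lemma frame_matrix (A : V -> V') :
  (forall x, Gamma M x ->
     exists2 y, Gamma M' y & forall v, A (gamma x v) = gamma y (A v)) ->
  exists X : 'M[int]_(dimT M', dimT M), forall z v,
    A (gamma (iota (map_mx intr z)) v) = gamma (iota' (map_mx intr (X *m z))) (A v).
Proof.
have [_ _ G _ _] := fr; have [ik' _ G' _ _] := fr'.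
move=> hA.
have ex z : exists z', forall v,
    A (gamma (iota (map_mx intr z)) v) = gamma (iota' (map_mx intr z')) (A v).
  have [|y /G'[z' ->] E] := hA (iota (map_mx intr z)); last by exists z'.
  by apply/G; exists z.
have [h hE] := choice ex.
suff /additive_int_matrix[X XE] : {morph h : x y / x + y}.
  by exists X => z v; rewrite -XE.
move=> z w; apply: (@map_intr_mx_inj R).
apply: (can_inj ik'); apply: (@gamma_inj _ _ _ _ (A 0)).
rewrite -hE !map_mxD !linearD /= -!gammaD -!hE //.
Qed.

End LatticeMatrix.

Lemma mulmx_id_int m (N : 'M[int]_m) : (forall z : 'cV[int]_m, N *m z = z) -> N = 1%:M.
Proof.
move=> h; apply/matrixP => i j; have /colP/(_ i) := h (delta_mx j 0).
by rewrite -colE !mxE andbT.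
Qed.

Lemma is_derive_ray (R : realType) (n : nat) (w : 'rV[R]_n) (t : R) :
  is_derive t (1 : R) (fun s : R => s *: w) w.
Proof.
have := is_derive_line (v := w) (p := 0) (t := t) (is_derive_id _ _).
by under eq_fun do rewrite add0r.
Qed.

Lemma Ck_ray (R : realType) (n : nat) (w : 'rV[R]_n) (U : set R) :
  smooth_on U (fun t : R => t *: w).
Proof.
have dw t := is_derive_ray w t.
case=> [|k] /=; first by move=> t _; exact: scalel_continuous.
split=> [t _|v]; first by apply/derivable1_diffP; have [] := dw t.
apply: (eq_ind_r (Ck k U) (Ck_cst k U (v *: w))); apply/funext => t.
have dt : differentiable (fun s : R => s *: w) t.
  by apply/derivable1_diffP; have [] := dw t.
rewrite deriveE // -[v in LHS]mulr1 -[v * 1]/(v *: 1) linearZ /= -deriveE //.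
by have [_ ->] := dw t.
Qed.

Section Forward.
Variables (R : realType) (M M' : realization R).
Local Notation V := 'rV[R]_(dimV M).
Local Notation V' := 'rV[R]_(dimV M').
Variables (f : manifold M -> manifold M').
Variables (L : {linear V -> V'}) (c : V').
Hypothesis fE : forall v, f (proj v) = proj (L v + c).
Hypothesis cf : causal f.

Lemma l0_proj v w : proj v = proj w :> manifold M' -> l0 v = l0 w.
Proof. by case/projP => x _ ->; exact: l0_gamma. Qed.

(* l0 descends to the quotient, so its growth along the image of the straight
   line in direction v0 + v1 can be read off any lift. *)
Lemma causal_l0_ge0 : 0 <= l0 (L (v0 M + v1 M)).
Proof.
pose w := v0 M + v1 M.
have cw : cone M w.
  by apply/coneE; rewrite /w !formE !lE !add0r ?addr0; split; rewrite ?addr_ge0.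
have dw t := is_derive_ray w t.
pose curve t := proj (t *: w) : manifold M.
have tc : timelike_curve setT curve.
  move=> t _; exists setT, (fun t : R => t *: w); split=> //.
  - exact: openT.
  - exact: Ck_ray.
  - by move=> s _; rewrite derive1E; have [_ ->] := dw s.
have [J [k [oJ J0 sk kE ck]]] := cf openT (fun _ _ _ _ _ _ => I) tc (I : setT (0 : R)).
have dk : is_derive (0 : R) 1 k (derive1 k 0).
  have [/(_ 0 J0) dk _] := sk 1%N.
  by rewrite derive1E; apply: derivableP; exact: diff_derivable.
have lin : linear (@l0 R M' : V' -> R^o) by move=> a u v; rewrite /l0 formDr formZr.
pose l0L : {linear V' -> R^o} := HB.pack (@l0 R M' : V' -> R^o)
  (GRing.isLinear.Build _ _ _ _ _ lin).
have d1 := is_derive_linear (@linear_rV_continuous _ _ _ l0L) dk.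
have d2 := is_derive_linear (@linear_rV_continuous _ _ _ l0L)
  (is_derive_affine_comp L c (dw 0)).
have E : \forall t \near (0 : R), (l0L \o k) t = (l0L \o (fun s : R => L (s *: w) + c)) t.
  apply: filterS (open_nbhs_nbhs (conj oJ J0)) => t Jt.
  by apply: l0_proj; rewrite kE //= fE.
have [_ E2] := near_eq_is_derive E d1.
have [_ E3] := d2.
have -> : l0 (L w) = l0 (derive1 k 0) by exact: etrans (esym E3) E2.
by have /coneE[_ + _] := ck 0 J0.
Qed.

Variables (Q : R -> 'M[R]_(dimT M)) (Q' : R -> 'M[R]_(dimT M')).
Hypotheses (sQ : forall s, (Q s)^T = Q s) (sQ' : forall s, (Q' s)^T = Q' s).
Variable (N : 'M[R]_(dimT M', dimT M)).
Hypothesis QE : forall v, Q (l0 v) = N^T *m Q' (l0 (L v + c)) *m N.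
Hypothesis surjL : forall w, exists v, L v = w.

Lemma affine_parameter : exists al be : R, 0 < al /\
  forall s, Q s = N^T *m Q' (al * s + be) *m N.
Proof.
have l0v1 s : l0 (s *: v1 M) = s by rewrite /l0 formZr l01 mulr1.
have [[u u0 Lu]|h] := pselect (exists2 u, l0 u = 0 & l0 (L u) != 0).
  exists 1, 0; split=> // s; rewrite -{1}(l0v1 s) QE.
  have Q'c r : N^T *m Q' r *m N = Q 0.
    pose t := (r - l0 c) / l0 (L u).
    have -> : r = l0 (L (t *: u) + c).
      by rewrite linearZ /= /l0 formDr formZr -!/(l0 _) mulfVK // subrK.
    by rewrite -QE /l0 formZr -/(l0 u) u0 mulr0.
  by rewrite !Q'c.
have LE v : l0 (L v) = l0 (L (v1 M)) * l0 v.
  have u0 : l0 (v - l0 v *: v1 M) = 0.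
    by rewrite /l0 formDr formNr formZr l01 mulr1 subrr.
  have /eqP : l0 (L (v - l0 v *: v1 M)) = 0.
    by apply/eqP/negPn/negP => n0; apply: h; exists (v - l0 v *: v1 M).
  rewrite linearB linearZ /= /l0 formDr formNr formZr subr_eq0 => /eqP ->.
  exact: mulrC.
exists (l0 (L (v1 M))), (l0 c); split; last first.
  move=> s; rewrite -{1}(l0v1 s) QE.
  by congr (_ *m Q' _ *m _); rewrite /l0 formDr -!/(l0 _) LE l0v1.
rewrite lt_neqAle; apply/andP; split; last first.
  by have := causal_l0_ge0; rewrite LE /l0 formDr l00 l01 add0r mulr1.
rewrite eq_sym; apply/eqP => al0; have [u Lu] := surjL (v1 M').
have := LE u; rewrite Lu al0 mul0r /l0 l01 => /eqP.
by rewrite oner_eq0.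
Qed.

End Forward.

Lemma isometric_equivalent (R : realType) (M M' : realization R)
    (Q : R -> 'M[R]_(dimT M)) (Q' : R -> 'M[R]_(dimT M')) :
  characteristic_polynomial M Q -> characteristic_polynomial M' Q' ->
  causally_isometric M M' ->
  dimV M = dimV M' /\ exists al be : R, 0 < al /\ integrally_equivalent Q Q' al be.
Proof.
move=> hQ hQ' [f [[pf [sf [g sg [fg gf]]]] cf]].
have nn' := isometry_dim pf sf sg gf; split=> //.
have [L [c [iL fE]]] := global_affine_lift pf sf sg gf.
have bnd := lorentz_nondegenerate (dimV_ge2 M) (ell_lorentzian M).
have n'n : (dimV M' <= dimV M)%N by rewrite nn'.
have surjL := form_isometry_surj n'n bnd iL.
have injL := form_isometry_inj bnd iL.
pose Lf : 'Hom('rV[R]_(dimV M), 'rV[R]_(dimV M')) := linfun L.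
have k0 : lker Lf == 0%VS by apply/lker0P => u v; rewrite !lfunE => /injL.
have LK u : (Lf^-1)%VF (L u) = u by rewrite -(lfunE L) lker0_lfunK.
have KL w : L ((Lf^-1)%VF w) = w by have [u <-] := surjL w; rewrite LK.
pose A v := L v + c; pose A' w := (Lf^-1)%VF w - (Lf^-1)%VF c.
have AK v : A' (A v) = v by rewrite /A' /A linearD /= addrK LK.
have KA w : A (A' w) = w by rewrite /A' /A linearB /= !KL subrK.
have gE w : g (proj w) = proj (A' w) by rewrite -{1}(KA w) -fE fg.
have [iota [kappa fr]] := characteristic_frame hQ.
have [iota' [kappa' fr']] := characteristic_frame hQ'.
have [X XE] := frame_matrix fr fr' (affine_equivariant fE).
have [Y YE] := frame_matrix fr' fr
  (affine_equivariant (c := - (Lf^-1)%VF c) (L := (Lf^-1)%VF) gE).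
rewrite -/(A _) in XE.
have [ik _ _ sQ qE] := fr; have [ik' _ _ sQ' qE'] := fr'.
have XY : X *m Y = 1%:M.
  apply: mulmx_id_int => w; apply: (@map_intr_mx_inj R); apply: (can_inj ik').
  apply: (@gamma_inj _ _ _ _ (A 0)); rewrite -mulmxA -XE.
  rewrite -[in LHS](AK 0) -YE; exact: KA.
have YX : Y *m X = 1%:M.
  apply: mulmx_id_int => w; apply: (@map_intr_mx_inj R); apply: (can_inj ik).
  apply: (@gamma_inj _ _ _ _ (A' 0)); rewrite -mulmxA -YE.
  rewrite -[in LHS](KA 0) -XE; exact: AK.
have QE v : Q (l0 v) = (map_mx intr X)^T *m Q' (l0 (L v + c)) *m map_mx intr X.
  apply: symmetric_mx_eq => //; first by rewrite !trmx_mul trmxK sQ' mulmxA.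
  move=> z; rewrite -qE !mulmxA -trmx_mul -!mulmxA mulmxA -map_mxM -qE'.
  rewrite !qform_gamma -XE; congr (- _); rewrite -[LHS]iL.
  by rewrite opprD addrACA subrr addr0 linearB.
have [al [be [al0 QE']]] := affine_parameter fE cf QE surjL.
by exists al, be; split=> //; exists X, Y; split.
Qed.

Theorem theorem2 (R : realType) (M M' : realization R)
    (Q : R -> 'M[R]_(dimT M)) (Q' : R -> 'M[R]_(dimT M'))
    (hQ : characteristic_polynomial M Q) (hQ' : characteristic_polynomial M' Q') :
  causally_isometric M M' <->
  (signature M = signature M' /\
   exists (eqm : dimT M' = dimT M) (X : 'M[int]_(dimT M)) (alpha beta : R),
     [/\ X \in unitmx, 0 < alpha &
         forall s : R, Q s = (map_mx intr X)^T
           *m castmx (eqm, eqm) (Q' (alpha * s + beta)) *m map_mx intr X]).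
Proof.
split=> [/(isometric_equivalent hQ hQ')[nn' [al [be [al0 eQ]]]]|].
  split; first exact: (equivalent_signature hQ hQ' nn' (lt0r_neq0 al0) eQ).
  have /integrally_equivalentP[eqm [X [uX E]]] := eQ.
  by exists eqm, X, al, be.
move=> [[nn' _ _ _] [eqm [X [al [be [uX al0 E]]]]]].
have eQ : integrally_equivalent Q Q' al be.
  by apply/integrally_equivalentP; exists eqm, X.
have [phi [psi [_ K Gphi Gpsi sim]]] := equivalent_similarity hQ hQ' eQ.
exact: (similarity_causally_isometric sim al0 nn' K Gphi Gpsi).
Qed.
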